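(* Let $\Phi$ be the spectrum with $N$-th space $\Phi_N^N$ and structure maps \[\omega_N:\Phi_N^N\to\Omega\Phi_{N+1}^{N+1},\qquad \phi\mapsto\big(t\mapsto \phi(-)+(0,\dots,0,t)\big).\] There is an equivalence between the spectrum $\Phi$ and the sphere spectrum $\mathbb{S}$.
   Context: $I=[0,1]$. $\mathrm{UConf}(n,X)$ is the space of unordered configurations of $n$ distinct points of $X$. For $N\in\mathbb{N}$, $0\le k\le N$ and $n\in\mathbb{N}$, let $\Psi_n(\mathbb{R}\times\mathbb{R}^k\times I^{N-k})$ be the space (with the compact-open topology) of continuous maps $\phi:\mathbb{R}\to\mathbb{R}\times\mathrm{UConf}(n,\mathbb{R}^k\times I^{N-k})$ of the form $\phi(t)=(t,z_\phi(t))$. The image $\operatorname{im}(\phi)$ is regarded as a subset of $\mathbb{R}\times\mathbb{R}^k\times I^{N-k}$ (the union over $t$ of $\{t\}\times z_\phi(t)$). For $R\in\mathbb{N}$ let $P_R=[-\tfrac R2,\tfrac R2]\times B_R^k(0)\times I^{N-k}$, where $B_R^k(0)\subset\mathbb{R}^k$ is the cube of center $0$ and side $R$. Write $\phi\sim_{P_R}\psi$ if $\operatorname{im}(\phi)\cap P_R=\operatorname{im}(\psi)\cap P_R$, and set \[\Phi_k^N:=\lim_{R\in\mathbb{N}}\Big(\bigsqcup_n\Psi_n(\mathbb{R}\times\mathbb{R}^k\times I^{N-k})\Big)/\!\sim_{P_R},\] with the quotient topologies and the limit along the evident projection maps. $\Phi_k^N$ is based at the empty path (the ''point at infinity''). In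 particular $\Phi_N^N$ is the case $k=N$, where all the space directions are $\mathbb{R}^N$. In the definition of $\omega_N$, the circle $S^1$ is the one-point compactification $\mathbb{R}\cup\{\infty\}$, $\phi\in\Phi_N^N$ is regarded as an element of $\Phi_{N+1}^{N+1}$ via the inclusion $\mathbb{R}\times\mathbb{R}^N\times\{0\}\subset\mathbb{R}\times\mathbb{R}^{N+1}$, it is translated by $t$ in the last coordinate, and $t=\infty$ is sent to the empty path. An equivalence of spectra means that they are related by a zigzag of weak equivalences of spectra. *)

(* Defs.v *)
From HB Require Import structures.
From Stdlib Require Import Relation_Operators.
From mathcomp Require Import all_boot all_order perm all_algebra.
From mathcomp Require Import all_classical all_reals topology normedtype.

Set Implicit Arguments.
Unset Strict Implicit.
Unset Printing Implicit Defensive.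

Import Order.TTheory GRing.Theory Num.Theory.
Import numFieldNormedType.Exports.

Local Open Scope classical_set_scope.
Local Open Scope ring_scope.
Local Open Scope quotient_scope.

Record pmap (X Y : ptopologicalType) := Pmap {
  pmap_fun :> X -> Y;
  pmap_continuous : continuous pmap_fun;
  pmap_point : pmap_fun point = point }.

Lemma pmapP (X Y : ptopologicalType) (f g : pmap X Y) : f =1 g -> f = g.
Proof.
case: f g => f cf pf [g cg pg] /= /funext fg; case: _ / fg in cg pg *.
by rewrite (Prop_irrelevance cf cg) (Prop_irrelevance pf pg).
Qed.

Lemma pmap_comp_point (X Y Z : ptopologicalType) (g : pmap Y Z) (f : pmap X Y) :
  (g \o f) point = point.
Proof. by rewrite /= !pmap_point. Qed.

Definition pmap_comp (X Y Z : ptopologicalType) (g : pmap Y Z) (f : pmap X Y) :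
    pmap X Z :=
  Pmap (fun x => continuous_comp (pmap_continuous (x := x))
                                 (pmap_continuous (x := f x)))
       (pmap_comp_point g f).

Section Fixed_reals.
Variable R : realType.

Definition circle : ptopologicalType := one_point_compactification R.

Definition is_loop (X : ptopologicalType) : set (circle -> X) :=
  [set f | continuous f /\ f point = point].

Definition loop_space (X : ptopologicalType) : Type :=
  (@is_loop X : set {compact-open, circle -> X}).

HB.instance Definition _ (X : ptopologicalType) :=
  Topological.copy (loop_space X)
    (set_type (@is_loop X : set {compact-open, circle -> X})).

Definition Loop (X : ptopologicalType) (f : circle -> X) (cf : continuous f)
    (fp : f point = point) : loop_space X :=
  exist (fun g => g \in @is_loop X) f (mem_set (conj cf fp)).

Lemma cst_loop_continuous (X : ptopologicalType) :
  continuous (cst point : circle -> X).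
Proof. exact: cst_continuous. Qed.

HB.instance Definition _ (X : ptopologicalType) :=
  isPointed.Build (loop_space X) (Loop (@cst_loop_continuous X) erefl).

Definition loop (X : ptopologicalType) : ptopologicalType := loop_space X.

Definition loop_fun (X : ptopologicalType) (f : loop X) : circle -> X := val f.
Arguments loop_fun {X} f.

Lemma loop_funP (X : ptopologicalType) (f g : loop X) :
  loop_fun f =1 loop_fun g -> f = g.
Proof. by move=> fg; apply: val_inj; apply/funext. Qed.

Lemma loop_fun_continuous (X : ptopologicalType) (f : loop X) :
  continuous (loop_fun f).
Proof. by have [] := set_mem (valP f). Qed.

Lemma loop_fun_point (X : ptopologicalType) (f : loop X) : loop_fun f point = point.
Proof. by have [] := set_mem (valP f). Qed.

Lemma continuous_loop_fun (X : ptopologicalType) :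
  continuous (loop_fun : loop X -> {compact-open, circle -> X}).
Proof. exact: initial_continuous. Qed.

Lemma continuous_loop (T : topologicalType) (X : ptopologicalType)
    (F : T -> loop X) :
  continuous (loop_fun \o F : T -> {compact-open, circle -> X}) -> continuous F.
Proof. exact: continuous_comp_initial. Qed.

Section Adjoint.
Variables (X Y : ptopologicalType) (f : X * circle -> Y).
Hypothesis f_continuous : continuous f.
Hypothesis f_pointl : forall t, f (point, t) = point.
Hypothesis f_pointr : forall x, f (x, point) = point.

Definition adjoint_fun (x : X) : loop Y :=
  Loop ((continuous_curry f_continuous).2 x) (f_pointr x).

Lemma adjoint_continuous : continuous adjoint_fun.
Proof. exact/continuous_loop/(continuous_curry f_continuous).1. Qed.

Lemma adjoint_point : adjoint_fun point = point.
Proof. by apply: loop_funP => t; exact: f_pointl. Qed.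

Definition adjoint : pmap X (loop Y) := Pmap adjoint_continuous adjoint_point.

End Adjoint.

Section Loop_map.
Variables (X Y : ptopologicalType) (f : pmap X Y).

Lemma loop_map_loop_continuous (g : loop X) : continuous (f \o loop_fun g).
Proof.
move=> t; apply: continuous_comp; first exact: loop_fun_continuous.
exact: pmap_continuous.
Qed.

Lemma loop_map_loop_point (g : loop X) : (f \o loop_fun g) point = point.
Proof. by rewrite /= loop_fun_point pmap_point. Qed.

Definition loop_map_fun (g : loop X) : loop Y :=
  Loop (@loop_map_loop_continuous g) (loop_map_loop_point g).

Lemma loop_map_continuous : continuous loop_map_fun.
Proof.
apply: continuous_loop => g; apply/compact_open_cvgP.
  exact/fmap_filter/nbhs_filter.
move=> K O cK oO fgKO.
have sub : nbhs (loop_fun g : {compact-open, circle -> X})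
    [set h | h @` K `<=` f @^-1` O].
  apply: open_nbhs_nbhs; split.
    apply: compact_open_open => //.
    by apply: open_comp => // x _; exact: pmap_continuous.
  by move=> _ [t Kt <-]; apply: fgKO; exists t.
have := @continuous_loop_fun X g _ sub.
apply: (@filterS (loop X) (nbhs g)) => h hKO _ [t Kt <-].
by apply: hKO; exists t.
Qed.

Lemma loop_map_point : loop_map_fun point = point.
Proof. by apply: loop_funP => t; exact: pmap_point. Qed.

Definition loop_map : pmap (loop X) (loop Y) :=
  Pmap loop_map_continuous loop_map_point.

End Loop_map.

Lemma loop_map_comp (X Y Z : ptopologicalType) (g : pmap Y Z) (f : pmap X Y) :
  loop_map (pmap_comp g f) = pmap_comp (loop_map g) (loop_map f).
Proof. by apply: pmapP => h; apply: loop_funP. Qed.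

Fixpoint loopn (m : nat) (X : ptopologicalType) : ptopologicalType :=
  if m is m'.+1 then loopn m' (loop X) else X.

Fixpoint loopn_map (m : nat) (X Y : ptopologicalType) :
    pmap X Y -> pmap (loopn m X) (loopn m Y) :=
  if m is m'.+1 then fun f => loopn_map m' (loop_map f) else id.

Lemma loopn_map_comp (m : nat) (X Y Z : ptopologicalType) (g : pmap Y Z)
    (f : pmap X Y) :
  loopn_map m (pmap_comp g f) = pmap_comp (loopn_map m g) (loopn_map m f).
Proof.
elim: m X Y Z g f => [//|m IHm] X Y Z g f.
by rewrite /= loop_map_comp IHm.
Qed.

Definition path_joined (X : topologicalType) (x y : X) : Prop :=
  exists g : R -> X, [/\ {within `[0, 1], continuous g}, g 0 = x & g 1 = y].

Lemma path_joined_pmap (X Y : ptopologicalType) (f : pmap X Y) (x y : X) :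
  path_joined x y -> path_joined (f x) (f y).
Proof.
move=> [g [cg <- <-]]; exists (f \o g); split=> //.
by apply: within_continuous_comp => // z _; exact: pmap_continuous.
Qed.

Record spectrum := Spectrum {
  level :> nat -> ptopologicalType;
  structure_map : forall n, pmap (level n) (loop (level n.+1)) }.

Record spectrum_map (E F : spectrum) := SpectrumMap {
  level_map :> forall n, pmap (E n) (F n);
  level_map_structure : forall n,
    pmap_comp (loop_map (level_map n.+1)) (structure_map E n) =
    pmap_comp (structure_map F n) (level_map n) }.

(* [stable_pi E p q] is the colimit over j of the sets
   pi_(j+p) (E_(j+q)) = pi_0 (Omega^(j+p) E_(j+q)) along
   Omega^(j+p) E_(j+q) -> Omega^(j+p) Omega E_(j+q+1); as a colimit of sets it
   is the quotient of the disjoint union by the generated equivalence. *)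
Section Stable_homotopy.
Variables p q : nat.

Definition stable_rep (E : spectrum) : Type :=
  {j : nat & loopn (j + p) (E (j + q)%N)}.

HB.instance Definition _ (E : spectrum) := Choice.on (stable_rep E).

Inductive stable_step (E : spectrum) : stable_rep E -> stable_rep E -> Prop :=
| stable_step_path (j : nat) (a b : loopn (j + p) (E (j + q)%N)) :
    path_joined a b ->
    stable_step (existT _ j a : stable_rep E) (existT _ j b)
| stable_step_structure (j : nat) (a : loopn (j + p) (E (j + q)%N)) :
    stable_step (existT _ j a : stable_rep E)
      (existT _ j.+1 (loopn_map (j + p) (structure_map E (j + q)) a)).

Definition stable_eq (E : spectrum) : rel (stable_rep E) :=
  fun x y => `[< clos_refl_sym_trans _ (@stable_step E) x y >].

Lemma stable_eq_refl (E : spectrum) : reflexive (@stable_eq E).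
Proof. by move=> x; apply/asboolP; exact: rst_refl. Qed.

Lemma stable_eq_sym (E : spectrum) : symmetric (@stable_eq E).
Proof. by move=> x y; apply/asboolP/asboolP; exact: rst_sym. Qed.

Lemma stable_eq_trans (E : spectrum) : transitive (@stable_eq E).
Proof.
by move=> y x z /asboolP xy /asboolP yz; apply/asboolP; exact: rst_trans xy yz.
Qed.

Canonical stable_equiv (E : spectrum) :=
  EquivRel (@stable_eq E) (@stable_eq_refl E) (@stable_eq_sym E)
    (@stable_eq_trans E).

Definition stable_pi (E : spectrum) : Type := {eq_quot stable_equiv E}.

HB.instance Definition _ (E : spectrum) :=
  Quotient.copy (stable_pi E) {eq_quot stable_equiv E}.

Definition stable_rep_map (E F : spectrum) (f : spectrum_map E F)
    (x : stable_rep E) : stable_rep F :=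
  existT _ (projT1 x) (loopn_map _ (f _) (projT2 x)).

Definition stable_pi_map (E F : spectrum) (f : spectrum_map E F)
    (x : stable_pi E) : stable_pi F :=
  \pi_(stable_pi F) (stable_rep_map f (repr x)).

Lemma stable_rep_map_eq (E F : spectrum) (f : spectrum_map E F)
    (x y : stable_rep E) :
  clos_refl_sym_trans _ (@stable_step E) x y ->
  clos_refl_sym_trans _ (@stable_step F)
    (stable_rep_map f x) (stable_rep_map f y).
Proof.
elim=> {x y} [_ _ [j a b ab|j a]|x|x y _|x y z _ + _].
- exact: rst_step (stable_step_path (path_joined_pmap _ ab)).
- apply: rst_step; rewrite /stable_rep_map /=.
  have -> : loopn_map (j + p) (loop_map (f (j + q).+1))
      (loopn_map (j + p) (structure_map E (j + q)) a) =
      loopn_map (j + p) (structure_map F (j + q))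
      (loopn_map (j + p) (f (j + q)%N) a).
    have := congr1 (fun h => loopn_map (j + p) h a)
      (level_map_structure f (j + q)).
    by rewrite /= !loopn_map_comp.
  exact: stable_step_structure.
- exact: rst_refl.
- exact: rst_sym.
- exact: rst_trans.
Qed.

Lemma stable_pi_mapE (E F : spectrum) (f : spectrum_map E F)
    (x : stable_rep E) :
  stable_pi_map f (\pi_(stable_pi E) x) =
  \pi_(stable_pi F) (stable_rep_map f x).
Proof.
have /eqmodP/asboolP rx : repr (\pi_(stable_pi E) x) = x %[mod stable_pi E].
  by rewrite reprK.
exact/eqmodP/asboolP/stable_rep_map_eq.
Qed.

End Stable_homotopy.

(* The integer k is nonneg_part k - neg_part k, one of the two being 0. *)
Definition nonneg_part (k : int) : nat := if k is Posz p then p else 0.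
Definition neg_part (k : int) : nat := if k is Negz q then q.+1 else 0.

Definition stable_homotopy (k : int) (E : spectrum) : Type :=
  stable_pi (nonneg_part k) (neg_part k) E.

Definition stable_homotopy_map (k : int) (E F : spectrum)
    (f : spectrum_map E F) : stable_homotopy k E -> stable_homotopy k F :=
  @stable_pi_map (nonneg_part k) (neg_part k) E F f.

(* The induced maps are group homomorphisms, so that they are isomorphisms if
   and only if they are bijective. *)
Definition weak_equivalence (E F : spectrum) (f : spectrum_map E F) : Prop :=
  forall k : int, bijective (@stable_homotopy_map k E F f).

Definition spectrum_equiv : spectrum -> spectrum -> Prop :=
  clos_refl_sym_trans spectrum
    (fun E F => exists f : spectrum_map E F, weak_equivalence f).

Lemma mx_continuous (T : topologicalType) (m n : nat) (f : T -> 'M[R]_(m, n)) :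
  (forall i j, continuous (fun x => f x i j)) -> continuous f.
Proof.
move=> cf x U [P fxP PU].
have : \forall y \near x, forall i j, P i j (f y i j).
  apply: filter_forall => i; apply: filter_forall => j.
  exact/(cf i j x)/fxP.
by apply: filterS => y Py; exact: PU.
Qed.

(* The point (x, t) = (x, 0) + (0, ..., 0, t) of R^(N+1). *)
Definition snoc (N : nat) (x : 'rV[R]_N) (t : R) : 'rV[R]_N.+1 :=
  \row_i oapp (x ord0) t (unlift ord_max i).

Lemma snoc_max (N : nat) (x : 'rV[R]_N) (t : R) : snoc x t ord0 ord_max = t.
Proof. by rewrite mxE unlift_none. Qed.

Lemma snoc_lift (N : nat) (x : 'rV[R]_N) (t : R) (j : 'I_N) :
  snoc x t ord0 (lift ord_max j) = x ord0 j.
Proof. by rewrite mxE liftK. Qed.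

Lemma snoc_inj (N : nat) (t : R) : injective (fun x : 'rV[R]_N => snoc x t).
Proof.
move=> x y /= xy; apply/rowP => j.
by rewrite -(snoc_lift x t) xy snoc_lift.
Qed.

Lemma snoc_continuous (N : nat) :
  continuous (fun xt : 'rV[R]_N * R => snoc xt.1 xt.2).
Proof.
apply: mx_continuous => i j [x t]; rewrite ord1.
case: (unliftP ord_max j) => [l|] ->.
- under eq_fun do rewrite snoc_lift.
  apply: (@continuous_comp _ _ _ fst (fun y : 'rV[R]_N => y ord0 l)).
    exact: cvg_fst.
  exact: coord_continuous.
- by under eq_fun do rewrite snoc_max; exact: cvg_snd.
Qed.

Definition sphere (N : nat) : ptopologicalType :=
  one_point_compactification 'rV[R]_N.

Definition sphere_snoc (N : nat) (xt : sphere N * circle) : sphere N.+1 :=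
  match xt with
  | (Some x, Some t) => Some (snoc x t)
  | _ => None
  end.

Lemma sphere_snoc_continuous (N : nat) : continuous (@sphere_snoc N).
Proof.
pose init (w : 'rV[R]_N.+1) : 'rV[R]_N := \row_j w ord0 (lift ord_max j).
have initE x t : init (snoc x t) = x by apply/rowP => j; rewrite mxE snoc_lift.
have init_continuous : continuous init.
  apply: mx_continuous => i j; under eq_fun do rewrite mxE.
  exact: coord_continuous.
have away_init (K : set 'rV[R]_N.+1) : compact K ->
    nbhs (None : sphere N) [set x | if x is Some v then ~ (init @` K) v else True].
  move=> cK; have cK' : compact (init @` K).
    exact/continuous_compact/cK/continuous_subspaceT.
  exists (init @` K); first by split=> //; exact: compact_closed (@norm_hausdorff _ _) cK'.
  by move=> _ [[v Kv <-]//|->].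
pose last (w : 'rV[R]_N.+1) : R := w ord0 ord_max.
have away_last (K : set 'rV[R]_N.+1) : compact K ->
    nbhs (None : circle) [set x | if x is Some v then ~ (last @` K) v else True].
  move=> cK; have cK' : compact (last @` K).
    apply/continuous_compact/cK/continuous_subspaceT.
    exact: coord_continuous.
  exists (last @` K); first by split=> //; exact: compact_closed (@norm_hausdorff _ _) cK'.
  by move=> _ [[v Kv <-]//|->].
move=> [[x|] t] U; first case: t => [t|].
- move=> /(snoc_continuous (x := (x, t))) [[A B] /= [xA tB] ABU].
  exists (Some @` A, Some @` B).
    by split; exact: one_point_compactification_some_nbhs.
  by move=> [_ _] /= [[y Ay <-] [s Bs <-]]; exact: (ABU (y, s)).
- move=> [K [cK _] KU]; eexists (setT, _).
    by split; [exact: filterT|exact: away_last cK].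
  move=> [[y|] [s|]] /= [_ Ks]; apply: KU; [left|by right..].
  exists (snoc y s) => // Kys; apply: Ks; exists (snoc y s) => //.
  exact: snoc_max.
- move=> [K [cK _] KU]; eexists (_, setT).
    by split; [exact: away_init cK|exact: filterT].
  move=> [[y|] [s|]] /= [Ky _]; apply: KU; [left|by right..].
  exists (snoc y s) => // Kys; apply: Ky; exists (snoc y s) => //.
Qed.

Lemma sphere_snoc_pointl (N : nat) (t : circle) :
  @sphere_snoc N (point, t) = point.
Proof. by []. Qed.

Lemma sphere_snoc_pointr (N : nat) (x : sphere N) :
  @sphere_snoc N (x, point) = point.
Proof. by case: x. Qed.

Definition sphere_spectrum : spectrum :=
  Spectrum (fun N => adjoint (@sphere_snoc_continuous N)
    (@sphere_snoc_pointl N) (@sphere_snoc_pointr N)).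

Section Unordered_configurations.
Variables (n : nat) (X : topologicalType).

Definition ordered_conf : Type :=
  [set x : {ptws 'I_n -> X} | injective x].

HB.instance Definition _ :=
  Topological.copy ordered_conf
    (set_type [set x : {ptws 'I_n -> X} | injective x]).

Definition OrderedConf (x : 'I_n -> X) (x_inj : injective x) : ordered_conf :=
  exist (fun y : {ptws 'I_n -> X} => y \in [set y | injective y]) x
    (mem_set x_inj).

Definition conf_point (x : ordered_conf) : 'I_n -> X := val x.

Lemma conf_point_inj (x : ordered_conf) : injective (conf_point x).
Proof. exact: set_mem (valP x). Qed.

Definition same_conf : rel ordered_conf := fun x y =>
  `[< exists s : 'S_n, forall i, conf_point y i = conf_point x (s i) >].

Lemma same_conf_refl : reflexive same_conf.
Proof. by move=> x; apply/asboolP; exists 1%g => i; rewrite perm1. Qed.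

Lemma same_conf_sym : symmetric same_conf.
Proof.
by move=> x y; apply/asboolP/asboolP => -[s xy]; exists s^-1%g => i;
  rewrite xy permKV.
Qed.

Lemma same_conf_trans : transitive same_conf.
Proof.
move=> y x z /asboolP[s xy] /asboolP[u yz]; apply/asboolP.
by exists (u * s)%g => i; rewrite yz xy permM.
Qed.

Canonical same_conf_equiv :=
  EquivRel same_conf same_conf_refl same_conf_sym same_conf_trans.

Definition uconf : topologicalType :=
  quotient_topology {eq_quot same_conf_equiv}.

Definition uconf_set (c : uconf) : set X := range (conf_point (repr c)).

Lemma uconf_set_pi (x : ordered_conf) :
  uconf_set (\pi_uconf x) = range (conf_point x).
Proof.
have /eqmodP/asboolP[s xs] : x = repr (\pi_uconf x) %[mod uconf].
  by rewrite reprK.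
rewrite eqEsubset; split=> _ [i _ <-]; first by rewrite xs; exists (s i).
by exists (s^-1%g i) => //; rewrite xs permKV.
Qed.

End Unordered_configurations.

Lemma continuousT_comp (T U V : topologicalType) (f : T -> U) (g : U -> V) :
  continuous f -> continuous g -> continuous (g \o f).
Proof. by move=> cf cg x; apply: continuous_comp; [exact: cf|exact: cg]. Qed.

Lemma pair_continuous (T U V : topologicalType) (f : T -> U) (g : T -> V) :
  continuous f -> continuous g -> continuous (fun x => (f x, g x)).
Proof. by move=> cf cg x; apply: cvg_pair; [exact: cf|exact: cg]. Qed.

Lemma fst_continuous (T U : topologicalType) : continuous (@fst T U).
Proof. by move=> x; exact: cvg_fst. Qed.

Lemma snd_continuous (T U : topologicalType) : continuous (@snd T U).
Proof. by move=> x; exact: cvg_snd. Qed.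

Section Paths_of_configurations.
Variables (n : nat) (X : topologicalType).

Definition is_conf_path : set (R -> (R * uconf n X)%type) :=
  [set phi | continuous phi /\ forall t, (phi t).1 = t].

Definition conf_path : Type :=
  (is_conf_path : set {compact-open, R -> (R * uconf n X)%type}).

HB.instance Definition _ :=
  Topological.copy conf_path
    (set_type (is_conf_path : set {compact-open, R -> (R * uconf n X)%type})).

Definition ConfPath (phi : R -> (R * uconf n X)%type)
    (phi_continuous : continuous phi) (phi1 : forall t, (phi t).1 = t) :
    conf_path :=
  exist (fun psi => psi \in is_conf_path) phi
    (mem_set (conj phi_continuous phi1)).

Definition path_fun (phi : conf_path) : R -> (R * uconf n X)%type := val phi.

Lemma path_fun_continuous (phi : conf_path) : continuous (path_fun phi).
Proof. by have [] := set_mem (valP phi). Qed.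

Lemma continuous_path_fun :
  continuous (path_fun : conf_path -> {compact-open, R -> (R * uconf n X)%type}).
Proof. exact: initial_continuous. Qed.

Lemma eval_path_continuous :
  continuous (fun xs : conf_path * R => path_fun xs.1 xs.2).
Proof.
have -> : (fun xs : conf_path * R => path_fun xs.1 xs.2) = uncurry path_fun.
  by apply/funext => -[].
exact: (continuous_uncurry (@locally_compactR R) (@Rhausdorff R)
  continuous_path_fun path_fun_continuous).
Qed.

Definition path_image (phi : conf_path) : set (R * X) :=
  [set p | exists2 t, p.1 = t & uconf_set (path_fun phi t).2 p.2].

End Paths_of_configurations.

Lemma ptws_continuous (T : topologicalType) (I : Type)
    (K : I -> topologicalType) (f : T -> prod_topology K) :
  (forall i, continuous (fun x => f x i)) -> continuous f.
Proof.
move=> cf x; apply/cvg_sup => i.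
exact: (@continuous_comp_initial _ T (K i) (fun g => g i) f (cf i) x).
Qed.

Section Moving_configurations.
Variables (n : nat) (X Y : topologicalType) (F : R -> X -> Y).
Hypothesis F_inj : forall t, injective (F t).

Definition ordered_move (t : R) (x : ordered_conf n X) : ordered_conf n Y :=
  OrderedConf (inj_comp (@F_inj t) (@conf_point_inj _ _ x)).

Definition uconf_move (t : R) (c : uconf n X) : uconf n Y :=
  \pi_(uconf n Y) (ordered_move t (repr c)).

Lemma uconf_move_pi (t : R) (x : ordered_conf n X) :
  uconf_move t (\pi_(uconf n X) x) = \pi_(uconf n Y) (ordered_move t x).
Proof.
have /eqmodP/asboolP[s xs] :
  repr (\pi_(uconf n X) x) = x %[mod uconf n X] by rewrite reprK.
apply/eqmodP/asboolP; exists s => i.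
by rewrite /ordered_move /conf_point /= -!/(conf_point _) xs.
Qed.

Lemma uconf_set_move (t : R) (c : uconf n X) :
  uconf_set (uconf_move t c) = F t @` uconf_set c.
Proof.
rewrite uconf_set_pi eqEsubset; split.
  by move=> _ [i _ <-]; eexists; first by exists i.
by move=> _ [_ [i _ <-] <-]; exists i.
Qed.

Hypothesis F_continuous : continuous (fun xt : X * R => F xt.2 xt.1).

Lemma uconf_move_continuous :
  continuous (fun ct : uconf n X * R => uconf_move ct.2 ct.1).
Proof.
pose G (x : ordered_conf n X) (t : R) : uconf n Y :=
  \pi_(uconf n Y) (ordered_move t x).
have cG : continuous (uncurry G).
  have -> : uncurry G = \pi_(uconf n Y) \o
      (fun xt : ordered_conf n X * R => ordered_move xt.2 xt.1).
    by apply/funext => -[].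
  apply: continuousT_comp; last exact: pi_continuous.
  apply: continuous_comp_initial; apply: ptws_continuous => i.
  apply: (continuousT_comp (f := fun xt => (conf_point xt.1 i, xt.2)))
    F_continuous; apply: pair_continuous; last exact: snd_continuous.
  apply: (continuousT_comp (f := fst) (g := fun x => conf_point x i)).
    exact: fst_continuous.
  apply: (@continuousT_comp _ {ptws 'I_n -> X} _ (@conf_point n X)
    (fun f => f i)); first exact: initial_continuous.
  exact: proj_continuous.
have [cG1 cG2] := continuous_curry cG.
pose H (c : uconf n X) : {compact-open, R -> uconf n Y} :=
  fun t => uconf_move t c.
have HE : H \o \pi_(uconf n X) = G.
  by apply/funext => x; apply/funext => t; exact: uconf_move_pi.
have cH : continuous H by apply/quotient_continuous; rewrite HE.
have cHc c : continuous (H c).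
  have -> : H c = G (repr c) by rewrite -HE /= reprK.
  exact: cG2.
have -> : (fun ct : uconf n X * R => uconf_move ct.2 ct.1) = uncurry H.
  by apply/funext => -[].
exact: (continuous_uncurry (@locally_compactR R) (@Rhausdorff R) cH cHc).
Qed.

Lemma path_move_path_continuous (t : R) (phi : conf_path n X) :
  continuous (fun s => (s, uconf_move t (path_fun phi s).2)).
Proof.
apply: pair_continuous; first by move=> s; exact: cvg_id.
apply: (continuousT_comp (f := fun s => ((path_fun phi s).2, t)))
  uconf_move_continuous.
apply: pair_continuous; last exact: cst_continuous.
apply: (continuousT_comp (f := path_fun phi) (g := snd)).
  exact: path_fun_continuous.
exact: snd_continuous.
Qed.

Definition path_move (t : R) (phi : conf_path n X) : conf_path n Y :=
  ConfPath (@path_move_path_continuous t phi) (fun=> erefl).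

Lemma path_image_move (t : R) (phi : conf_path n X) :
  path_image (path_move t phi) = (fun p => (p.1, F t p.2)) @` path_image phi.
Proof.
rewrite eqEsubset; split=> [[u y]|_ [[u x] [_ /= <- ux] <-]].
  move=> [_ /= <-]; rewrite uconf_set_move => -[x ux <-].
  by exists (u, x) => //; exists u.
by exists u => //=; rewrite uconf_set_move; exists x.
Qed.

Lemma path_move_continuous :
  continuous (fun xt : conf_path n X * R => path_move xt.2 xt.1).
Proof.
apply: continuous_comp_initial.
pose g (p : conf_path n X * R * R) : (R * uconf n Y)%type :=
  (p.2, uconf_move p.1.2 (path_fun p.1.1 p.2).2).
have cg : continuous g.
  apply: pair_continuous; first exact: snd_continuous.
  apply: (continuousT_comp
    (f := fun p : conf_path n X * R * R =>
            ((path_fun p.1.1 p.2).2, p.1.2))) uconf_move_continuous.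
  apply: pair_continuous; last first.
    apply: (continuousT_comp (f := fst) (g := snd)); first exact: fst_continuous.
    exact: snd_continuous.
  apply: (continuousT_comp
    (f := fun p : conf_path n X * R * R => path_fun p.1.1 p.2) (g := snd));
    last exact: snd_continuous.
  apply: (continuousT_comp
    (f := fun p : conf_path n X * R * R => (p.1.1, p.2)))
    (@eval_path_continuous n X).
  apply: pair_continuous; last exact: snd_continuous.
  apply: (continuousT_comp (f := fst) (g := fst)); exact: fst_continuous.
exact: (continuous_curry cg).1.
Qed.

End Moving_configurations.

Section Phi_spaces.
Variables k N : nat.

(* R^k * I^(N - k) *)
Definition slab_set : set 'rV[R]_N :=
  [set x | forall i : 'I_N, (k <= i)%N -> 0 <= x ord0 i <= 1].

Definition slab : topologicalType := set_type slab_set.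

Definition slab_val (x : slab) : 'rV[R]_N := val x.

Definition conf_paths : topologicalType := {n : nat & conf_path n slab}.

Definition im (phi : conf_paths) : set (R * slab) :=
  path_image (projT2 phi).

Definition conf_box (r : nat) : set (R * slab) :=
  [set p | `|p.1| <= r%:R / 2 /\
           forall i : 'I_N, (i < k)%N -> `|slab_val p.2 ord0 i| <= r%:R / 2].

Definition agree (r : nat) : rel conf_paths :=
  fun phi psi => `[< im phi `&` conf_box r = im psi `&` conf_box r >].

Lemma agree_refl (r : nat) : reflexive (agree r).
Proof. by move=> phi; apply/asboolP. Qed.

Lemma agree_sym (r : nat) : symmetric (agree r).
Proof. by move=> phi psi; apply/asboolP/asboolP => ->. Qed.

Lemma agree_trans (r : nat) : transitive (agree r).
Proof. by move=> psi phi chi /asboolP e /asboolP e'; apply/asboolP; rewrite e. Qed.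

Canonical agree_equiv (r : nat) :=
  EquivRel (agree r) (agree_refl r) (agree_sym r) (@agree_trans r).

Definition Phi_stage (r : nat) : topologicalType :=
  quotient_topology {eq_quot agree_equiv r}.

Definition stage_class (r : nat) (phi : conf_paths) : Phi_stage r :=
  \pi_(Phi_stage r) phi.

Definition stage_repr (r : nat) (x : Phi_stage r) : conf_paths := repr x.

Lemma stage_classP (r : nat) (phi psi : conf_paths) :
  reflect (stage_class r phi = stage_class r psi) (agree r phi psi).
Proof. by apply: (iffP idP) => [|/eqmodP]// a; exact/eqmodP. Qed.

Lemma stage_reprK (r : nat) (x : Phi_stage r) :
  stage_class r (stage_repr x) = x.
Proof. exact: reprK. Qed.

Definition stage_proj (r s : nat) (x : Phi_stage s) : Phi_stage r :=
  stage_class r (stage_repr x).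

Lemma agree_le (r s : nat) (phi psi : conf_paths) :
  (r <= s)%N -> agree s phi psi -> agree r phi psi.
Proof.
move=> rs /asboolP e; apply/asboolP.
have sub : conf_box r `<=` conf_box s.
  have le2 : r%:R / 2 <= s%:R / 2 :> R by rewrite ler_pM2r ?invr_gt0 ?ler_nat.
  move=> p [p1 p2]; split=> [|i ik]; first exact: le_trans le2.
  exact: le_trans (p2 i ik) le2.
have -> : conf_box r = conf_box s `&` conf_box r by rewrite setIidr.
by rewrite (setIA (im phi) (conf_box s)) (setIA (im psi) (conf_box s)) e.
Qed.

Lemma stage_proj_class (r s : nat) (phi : conf_paths) :
  (r <= s)%N -> stage_proj r (stage_class s phi) = stage_class r phi.
Proof.
move=> rs; apply/stage_classP/(agree_le rs)/stage_classP; exact: stage_reprK.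
Qed.

Definition is_thread : set (prod_topology Phi_stage) :=
  [set x | forall r s, (r <= s)%N -> stage_proj r (x s) = x r].

Definition Phi_type : Type := is_thread.

HB.instance Definition _ := Topological.copy Phi_type (set_type is_thread).

Definition Thread (x : forall r, Phi_stage r)
    (xP : forall r s, (r <= s)%N -> stage_proj r (x s) = x r) : Phi_type :=
  exist (fun y : prod_topology Phi_stage => y \in is_thread) x (mem_set xP).

Definition empty_conf : ordered_conf 0 slab :=
  @OrderedConf 0 slab (fun i : 'I_0 => False_rect slab (notF (ltn_ord i)))
    (fun i => False_ind _ (notF (ltn_ord i))).

Definition empty_path : conf_paths :=
  existT (fun n => conf_path n slab) 0
    (@ConfPath 0 slab (fun t => (t, \pi_(uconf 0 slab) empty_conf))
       (pair_continuous (fun t => @cvg_id _ (nbhs t)) (@cst_continuous _ _ _))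
       (fun=> erefl)).

Lemma im_empty_path : im empty_path = set0.
Proof.
rewrite -subset0 => -[u x] [t _] /=.
by rewrite uconf_set_pi => -[[]].
Qed.

HB.instance Definition _ := isPointed.Build Phi_type
  (Thread (fun r s => @stage_proj_class r s empty_path)).

Definition Phi : ptopologicalType := Phi_type.

Definition Phi_proj (r : nat) (x : Phi) : Phi_stage r := val x r.

Lemma PhiP (x y : Phi) : (forall r, Phi_proj r x = Phi_proj r y) -> x = y.
Proof. by move=> xy; apply/val_inj/functional_extensionality_dep. Qed.

Lemma Phi_projP (x : Phi) (r s : nat) :
  (r <= s)%N -> stage_proj r (Phi_proj s x) = Phi_proj r x.
Proof. exact: set_mem (valP x) r s. Qed.

Lemma Phi_proj_continuous (r : nat) : continuous (Phi_proj r).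
Proof.
have cv : continuous (fun x : Phi => (val x : prod_topology Phi_stage)).
  exact: initial_continuous.
exact: (continuousT_comp cv (@proj_continuous nat Phi_stage r)).
Qed.

Lemma continuous_Phi (T : topologicalType) (f : T -> Phi) :
  (forall r, continuous (Phi_proj r \o f)) -> continuous f.
Proof. by move=> cf; apply: continuous_comp_initial; exact: ptws_continuous. Qed.

End Phi_spaces.

Section Omega.
Variable N : nat.

Lemma slab_set_full (M : nat) (x : 'rV[R]_M) : x \in @slab_set M M.
Proof. by rewrite inE => i; rewrite leqNgt ltn_ord. Qed.

(* The inclusion R^N -> R^N * {0} followed by the translation by (0, ..., 0, t). *)
Definition translate (t : R) (x : slab N N) : slab N.+1 N.+1 :=
  exist (fun y => y \in @slab_set N.+1 N.+1) (snoc (slab_val x) t)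
    (slab_set_full _).

Lemma translate_inj (t : R) : injective (translate t).
Proof.
by move=> x y /(congr1 (@slab_val _ _)) /snoc_inj /val_inj.
Qed.

Lemma translate_continuous :
  continuous (fun xt : slab N N * R => translate xt.2 xt.1).
Proof.
apply: continuous_comp_initial.
apply: (continuousT_comp (f := fun xt => (slab_val xt.1, xt.2)))
  (@snoc_continuous N).
apply: pair_continuous; last exact: snd_continuous.
apply: (continuousT_comp (f := fst) (g := @slab_val N N)).
  exact: fst_continuous.
exact: initial_continuous.
Qed.

Definition paths_translate (t : R) (phi : conf_paths N N) :
    conf_paths N.+1 N.+1 :=
  existT (fun n => conf_path n (slab N.+1 N.+1)) (projT1 phi)
    (path_move translate_inj translate_continuous t (projT2 phi)).

Lemma im_translate (t : R) (phi : conf_paths N N) :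
  im (paths_translate t phi) =
  (fun p => (p.1, translate t p.2)) @` im phi.
Proof. exact: path_image_move. Qed.

Lemma box_translate (r : nat) (t u : R) (x : slab N N) :
  conf_box r (u, translate t x) <-> conf_box r (u, x) /\ `|t| <= r%:R / 2.
Proof.
split=> [[u_le tx_le]|[[u_le x_le] t_le]].
  split; first split=> // i _.
    by have := tx_le (lift ord_max i) (ltn_ord _); rewrite /= snoc_lift.
  by have := tx_le ord_max (ltn_ord _); rewrite /= snoc_max.
split=> // i _ /=; case: (unliftP ord_max i) => [j|] ->.
  by rewrite snoc_lift; exact: x_le (ltn_ord j).
by rewrite snoc_max.
Qed.

Lemma im_translate_box (r : nat) (t : R) (phi : conf_paths N N) :
  im (paths_translate t phi) `&` conf_box r =
  [set p | `|t| <= r%:R / 2 /\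
    ((fun p => (p.1, translate t p.2)) @` (im phi `&` conf_box r)) p].
Proof.
rewrite im_translate eqEsubset; split.
  by move=> _ [[[u x] ux <-] /box_translate[uxr tr]]; split=> //; exists (u, x).
move=> _ [tr [[u x] [ux uxr] <-]]; split; first by exists (u, x).
exact/box_translate.
Qed.

Lemma agree_translate (r : nat) (t : R) (phi psi : conf_paths N N) :
  agree r phi psi -> agree r (paths_translate t phi) (paths_translate t psi).
Proof. by move=> /asboolP e; apply/asboolP; rewrite !im_translate_box e. Qed.

Definition stage_translate (r : nat) (t : R) (x : Phi_stage N N r) :
    Phi_stage N.+1 N.+1 r :=
  stage_class r (paths_translate t (stage_repr x)).

Lemma stage_translate_class (r : nat) (t : R) (phi : conf_paths N N) :
  stage_translate t (stage_class r phi) = stage_class r (paths_translate t phi).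
Proof. by apply/stage_classP/agree_translate/stage_classP; exact: stage_reprK. Qed.

Lemma stage_translate_proj (r s : nat) (t : R) (x : Phi N N) : (r <= s)%N ->
  stage_proj r (stage_translate t (Phi_proj s x)) =
  stage_translate t (Phi_proj r x).
Proof.
move=> rs; rewrite stage_proj_class// -(Phi_projP x rs).
by rewrite -stage_translate_class.
Qed.

Definition Phi_translate (xt : Phi N N * circle) : Phi N.+1 N.+1 :=
  if xt.2 is Some t then
    Thread (fun r s => @stage_translate_proj r s t xt.1)
  else point.

Lemma stage_translate_continuous (r : nat) :
  continuous (fun xt : Phi_stage N N r * R => stage_translate xt.2 xt.1).
Proof.
pose G (phi : conf_paths N N) (t : R) : Phi_stage N.+1 N.+1 r :=
  stage_class r (paths_translate t phi).
pose g n (phi : conf_path n (slab N N)) : R -> Phi_stage N.+1 N.+1 r :=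
  G (existT _ n phi).
have cg n : continuous (uncurry (@g n)).
  have -> : uncurry (@g n) = stage_class r \o
      existT (fun n => conf_path n (slab N.+1 N.+1)) n \o
      (fun xt => path_move translate_inj translate_continuous xt.2 xt.1).
    by apply/funext => -[].
  apply: continuousT_comp; first exact: path_move_continuous.
  apply: continuousT_comp; first exact: existT_continuous.
  exact: pi_continuous.
pose H (x : Phi_stage N N r) : {compact-open, R -> Phi_stage N.+1 N.+1 r} :=
  fun t => stage_translate t x.
have HE : H \o stage_class r = G.
  by apply/funext => x; apply/funext => t; exact: stage_translate_class.
have cH : continuous H.
  apply/quotient_continuous; rewrite -/(stage_class r) HE.
  by case=> n phi; exact: (continuous_curry (cg n)).1 phi.
have cHx x : continuous (H x).
  have -> : H x = G (stage_repr x) by rewrite -HE /= stage_reprK.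
  by case: (stage_repr x) => n phi; exact: (continuous_curry (cg n)).2 phi.
have -> : (fun xt : Phi_stage N N r * R => stage_translate xt.2 xt.1) =
    uncurry H by apply/funext => -[].
exact: (continuous_uncurry (@locally_compactR R) (@Rhausdorff R) cH cHx).
Qed.

Lemma Phi_translate_continuous : continuous Phi_translate.
Proof.
apply: continuous_Phi => r [x [t|]].
- have c : continuous (fun xt : Phi N N * R =>
      Phi_proj r (Phi_translate (xt.1, Some xt.2))).
    apply: (continuousT_comp (f := fun xt => (Phi_proj r xt.1, xt.2)))
      (@stage_translate_continuous r).
    apply: pair_continuous; last exact: snd_continuous.
    apply: continuousT_comp; first exact: fst_continuous.
    exact: Phi_proj_continuous.
  move=> U /(c (x, t)) [[A B] /= [xA tB] ABU].
  exists (A, Some @` B).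
    by split=> //; exact: one_point_compactification_some_nbhs.
  by move=> [y _] /= [Ay [s Bs <-]]; exact: (ABU (y, s)).
- move=> U /nbhs_singleton U0.
  pose K : set R := [set` `[- (r%:R / 2), r%:R / 2]].
  exists (setT, (Some @` ~` K) `|` [set None]).
    split; first exact: filterT.
    by exists K => //; split; [exact: segment_compact|exact: interval_closed].
  move=> [y _] /= [_ [[t tK <-]|->]] //.
  rewrite /= (_ : Phi_proj r _ = Phi_proj r point) //.
  apply/stage_classP/asboolP; rewrite im_translate_box im_empty_path set0I.
  rewrite -subset0 => p [tr _]; apply: tK.
  by rewrite /K /= in_itv /= -ler_norml.
Qed.

Lemma Phi_translate_pointl (t : circle) : Phi_translate (point, t) = point.
Proof.
case: t => [t|//]; apply: PhiP => r.
rewrite -[LHS]/(stage_translate t (stage_class r (empty_path N N))).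
rewrite stage_translate_class; apply/stage_classP/asboolP.
by rewrite im_translate !im_empty_path image_set0.
Qed.

Lemma Phi_translate_pointr (x : Phi N N) : Phi_translate (x, point) = point.
Proof. by []. Qed.

Definition omega : pmap (Phi N N) (loop (Phi N.+1 N.+1)) :=
  adjoint Phi_translate_continuous Phi_translate_pointl Phi_translate_pointr.

End Omega.

Definition Phi_spectrum : spectrum := Spectrum omega.

End Fixed_reals.

(* Main.v *)
(** The sphere S^N embeds into Phi_N^N by sending a vector v to the constant path
    at the configuration {v} and infinity to the empty path; these embeddings
    commute strictly with the structure maps. Each of them is a pointed homotopy
    equivalence: the homotopy [zoom] contracts the time direction, which makes
    every path constant, and simultaneously pulls configurations back along the
    embedding y |-> y / (1 + u|y|) of R^N onto the open ball of radius 1/u, where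
    u grows from 0 to 1/rho and rho is the radius of an open ball around 0
    containing at most one point of the configuration at time 0. The largest
    such rho <= 1 depends continuously on the path, because whether a compact
    set contains at most one point and whether an open set contains at least two
    are both open conditions. At the end of the homotopy at most one constant
    point is left, the inverse being continuous since S^N is embedded. *)

From Stdlib Require Import Relation_Operators.
From mathcomp Require Import all_boot all_order all_algebra lra.
From mathcomp Require Import all_classical all_reals topology normedtype.
Require Import Defs.

Set Implicit Arguments.
Unset Strict Implicit.
Unset Printing Implicit Defensive.

Import Order.TTheory GRing.Theory Num.Theory.
Import numFieldNormedType.Exports.

Local Open Scope classical_set_scope.
Local Open Scope ring_scope.
Local Open Scope quotient_scope.

(** * Pointed homotopies and level equivalences of spectra *)

Section Pointed_homotopy.
Variable R : realType.

(** Uncurrying over the circle requires this. A finite x and infinity are separated by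
    [[x - 1, x + 1]] and its complement. *)
Lemma circle_hausdorff : hausdorff_space (circle R).
Proof.
have away (x : R) : exists U V : set (circle R),
    [/\ nbhs (Some x : circle R) U, nbhs (None : circle R) V & U `&` V = set0].
  pose K : set R := [set` `[x - 1, x + 1]].
  exists (Some @` K), ((Some @` ~` K) `|` [set None]); split.
  - apply: one_point_compactification_some_nbhs.
    apply: filterS (near_in_itvoo _) => [y|]; first exact: subset_itv_oo_cc.
    by rewrite in_itv /= gtrBl ltrDl ltr01.
  - by exists K => //; split; [exact: segment_compact|exact: interval_closed].
  - by rewrite -subset0 => _ [[y Ky <-] [[z nKz [zy]]|//]]; apply: nKz; rewrite zy.
move=> [x|] [y|] xy //.
- congr Some; apply: (@Rhausdorff R) => A B Ax By.
  have [] := xy _ _ (one_point_compactification_some_nbhs x A Ax)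
                    (one_point_compactification_some_nbhs y B By).
  by move=> _ [[u Au <-] [v Bv [vu]]]; exists u; split=> //; rewrite -vu.
- have [U [V [Ux Vy UV]]] := away x.
  by have := xy U V Ux Vy; rewrite UV => -[].
- have [U [V [Ux Vy UV]]] := away y.
  by have := xy V U Vy Ux; rewrite setIC UV => -[].
Qed.

Lemma circle_locally_compact : locally_compact [set: circle R].
Proof.
move=> x _; exists setT; first by rewrite withinET; exact: filterT.
by split; [exact: one_point_compactification_compact|exact: closedT].
Qed.

Lemma eval_loop_continuous (X : ptopologicalType) :
  continuous (fun gs : loop R X * circle R => loop_fun gs.1 gs.2).
Proof.
have -> : (fun gs : loop R X * circle R => loop_fun gs.1 gs.2) =
    uncurry (@loop_fun R X) by apply/funext => -[].
exact: (continuous_uncurry circle_locally_compact circle_hausdorff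
  (@continuous_loop_fun R X) (@loop_fun_continuous R X)).
Qed.

Definition pmap_id (X : ptopologicalType) : pmap X X :=
  @Pmap X X id (fun x => @cvg_id _ (nbhs x)) erefl.

Lemma pmap_compA (X Y Z W : ptopologicalType) (h : pmap Z W) (g : pmap Y Z)
    (f : pmap X Y) :
  pmap_comp h (pmap_comp g f) = pmap_comp (pmap_comp h g) f.
Proof. exact: pmapP. Qed.

Lemma pmap_comp1l (X Y : ptopologicalType) (f : pmap X Y) :
  pmap_comp (pmap_id Y) f = f.
Proof. exact: pmapP. Qed.

Lemma pmap_comp1r (X Y : ptopologicalType) (f : pmap X Y) :
  pmap_comp f (pmap_id X) = f.
Proof. exact: pmapP. Qed.

Lemma loop_map_id (X : ptopologicalType) :
  loop_map R (pmap_id X) = pmap_id (loop R X).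
Proof. by apply: pmapP => h; apply: loop_funP. Qed.

Lemma loopn_map_id (m : nat) (X : ptopologicalType) :
  loopn_map R m (pmap_id X) = pmap_id (loopn R m X).
Proof. by elim: m X => [//|m IHm] X; rewrite /= loop_map_id IHm. Qed.

(** The parameter runs over the whole line, with the ends read off at 0 and 1; the homotopy is
    pointed because each [H t] is. *)
Definition pmap_homotopic (X Y : ptopologicalType) (f g : pmap X Y) : Prop :=
  exists H : R -> pmap X Y,
    [/\ continuous (fun xt : X * R => H xt.2 xt.1), H 0 = f & H 1 = g].

Lemma pmap_homotopic_comp (X Y Z W : ptopologicalType) (h : pmap Z W)
    (f g : pmap Y Z) (k : pmap X Y) :
  pmap_homotopic f g ->
  pmap_homotopic (pmap_comp h (pmap_comp f k)) (pmap_comp h (pmap_comp g k)).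
Proof.
move=> [H [cH <- <-]]; exists (fun t => pmap_comp h (pmap_comp (H t) k)).
split=> //; apply: (continuousT_comp (f := fun xt => H xt.2 (k xt.1)) (g := h));
  last exact: pmap_continuous.
apply: (continuousT_comp (f := fun xt => (k xt.1, xt.2))) cH.
apply: pair_continuous; last exact: snd_continuous.
by apply: continuousT_comp; [exact: fst_continuous|exact: pmap_continuous].
Qed.

Lemma pmap_homotopic_path (X Y : ptopologicalType) (f g : pmap X Y) (x : X) :
  pmap_homotopic f g -> path_joined R (f x) (g x).
Proof.
move=> [H [cH <- <-]]; exists (fun t => H t x); split=> //.
apply: continuous_subspaceT.
apply: (continuousT_comp (f := fun t : R => (x, t))) cH.
by apply: pair_continuous; [exact: cst_continuous|move=> t; exact: cvg_id].
Qed.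

Lemma loop_map_homotopic (X Y : ptopologicalType) (f g : pmap X Y) :
  pmap_homotopic f g -> pmap_homotopic (loop_map R f) (loop_map R g).
Proof.
move=> [H [cH <- <-]]; exists (fun t => loop_map R (H t)); split=> //.
apply: continuous_loop.
pose h (p : loop R X * R * circle R) : Y := H p.1.2 (loop_fun p.1.1 p.2).
suff ch : continuous h by exact: (continuous_curry ch).1.
apply: (continuousT_comp
  (f := fun p : loop R X * R * circle R => (loop_fun p.1.1 p.2, p.1.2))) cH.
apply: pair_continuous.
  apply: (continuousT_comp
    (f := fun p : loop R X * R * circle R => (p.1.1, p.2)))
    (@eval_loop_continuous X).
  apply: pair_continuous; last exact: snd_continuous.
  apply: (continuousT_comp (f := fst) (g := fst)); exact: fst_continuous.
apply: (continuousT_comp (f := fst) (g := snd)).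
  exact: fst_continuous.
exact: snd_continuous.
Qed.

Lemma loopn_map_homotopic (m : nat) (X Y : ptopologicalType) (f g : pmap X Y) :
  pmap_homotopic f g -> pmap_homotopic (loopn_map R m f) (loopn_map R m g).
Proof.
by elim: m X Y f g => [//|m IHm] X Y f g fg; exact/IHm/loop_map_homotopic.
Qed.

End Pointed_homotopy.

(** * Levelwise homotopy equivalences induce bijections on stable homotopy *)

Section Level_equivalences.
Variables (R : realType) (E F : spectrum R) (f : spectrum_map E F).
Variable g : forall n, pmap (F n) (E n).
Hypothesis gf : forall n, pmap_homotopic R (pmap_comp (g n) (f n)) (pmap_id _).
Hypothesis fg : forall n, pmap_homotopic R (pmap_comp (f n) (g n)) (pmap_id _).

Section Indices.
Variables p q : nat.

Let stable (G : spectrum R) := clos_refl_sym_trans _ (@stable_step R p q G).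

Definition stable_rep_inv (x : stable_rep p q F) : stable_rep p q E :=
  existT _ (projT1 x) (loopn_map R _ (g _) (projT2 x)).

Lemma stable_homotopic (G : spectrum R) (X : ptopologicalType) (j : nat)
    (h k : pmap X (G (j + q)%N)) (a : loopn R (j + p) X) :
  pmap_homotopic R h k ->
  stable (existT _ j (loopn_map R _ h a) : stable_rep p q G)
         (existT _ j (loopn_map R _ k a)).
Proof.
move=> hk; apply/rst_step/stable_step_path.
exact/pmap_homotopic_path/loopn_map_homotopic.
Qed.

(* The maps [g n] commute with the structure maps only up to homotopy:
   with f and g homotopy inverse to each other,
   (loop g) o w ~ (loop g) o w o f o g = (loop (g o f)) o s o g ~ s o g. *)
Lemma stable_rep_inv_structure (j : nat) (a : loopn R (j + p) (F (j + q)%N)) :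
  stable (existT _ j (loopn_map R _ (g _) a) : stable_rep p q E)
    (existT _ j.+1 (loopn_map R (j.+1 + p) (g (j.+1 + q))
      (loopn_map R (j + p) (structure_map F (j + q)) a))).
Proof.
set n := (j + q)%N; set w := structure_map F n; set s := structure_map E n.
apply: rst_trans (rst_step _ _ _ _ (stable_step_structure _)) _.
pose lg := loop_map R (g n.+1); pose lf := loop_map R (f n.+1).
have step h k : pmap_homotopic R h k ->
    stable
      (existT _ j.+1 (loopn_map R (j + p) h a) : stable_rep p q E)
      (existT _ j.+1 (loopn_map R (j + p) k a)).
  (* [loopn] unfolds at its inner end, so [loopn (j.+1 + p)] of a level is by computation
     [loopn (j + p)] of its loop space. *)
  move=> hk; apply/rst_step/(@stable_step_path R p q E j.+1).
  exact/pmap_homotopic_path/loopn_map_homotopic.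
have comp h k : loopn_map R (j + p) h (loopn_map R (j + p) k a) =
    loopn_map R (j + p) (pmap_comp h k) a by rewrite loopn_map_comp.
rewrite [loopn_map R (j.+1 + p) _]/(loopn_map R (j + p) lg) !comp -/n -/s.
apply: (@rst_trans _ _ _
  (existT _ j.+1 (loopn_map R (j + p) (pmap_comp lg (pmap_comp w
    (pmap_comp (f n) (g n)))) a))).
  rewrite (_ : pmap_comp lg _ = pmap_comp (pmap_id _) (pmap_comp
    (loop_map R (pmap_comp (g n.+1) (f n.+1))) (pmap_comp s (g n)))); last first.
    rewrite pmap_comp1l loop_map_comp -/lg -/lf.
    rewrite !pmap_compA -!(pmap_compA lg) -/n.
    by rewrite -(level_map_structure f n).
  apply: rst_sym; apply: step.
  rewrite -[X in pmap_homotopic _ _ X](pmap_comp1l (pmap_comp s (g n))).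
  rewrite -[X in pmap_homotopic _ _ X](pmap_comp1l (pmap_comp _ _)).
  apply: pmap_homotopic_comp; rewrite -loop_map_id.
  exact/loop_map_homotopic/gf.
apply: step; rewrite pmap_compA.
have := pmap_homotopic_comp (pmap_comp lg w) (pmap_id _) (fg n).
by rewrite !pmap_comp1r.
Qed.

Lemma stable_rep_inv_eq (x y : stable_rep p q F) :
  stable x y -> stable (stable_rep_inv x) (stable_rep_inv y).
Proof.
elim=> {x y} [_ _ [j a b ab|j a]|x|x y _|x y z _ + _].
- exact: rst_step (stable_step_path (path_joined_pmap _ ab)).
- exact: stable_rep_inv_structure.
- exact: rst_refl.
- exact: rst_sym.
- exact: rst_trans.
Qed.

(** The inverse applies the maps [g n] to representatives. Both composites fix every class because
    homotopic maps induce maps of iterated loop spaces with path-joined values. *)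
Lemma stable_pi_map_bijective : bijective (@stable_pi_map R p q E F f).
Proof.
pose inv (y : stable_pi p q F) : stable_pi p q E :=
  \pi_(stable_pi p q E) (stable_rep_inv (repr y)).
have invE (y : stable_rep p q F) : inv (\pi_(stable_pi p q F) y) =
    \pi_(stable_pi p q E) (stable_rep_inv y).
  have /eqmodP/asboolP ry :
      repr (\pi_(stable_pi p q F) y) = y %[mod stable_pi p q F].
    by rewrite reprK.
  exact/eqmodP/asboolP/stable_rep_inv_eq.
exists inv => x; rewrite -[x]reprK.
  case: (repr x) => j a; rewrite stable_pi_mapE invE; apply/eqmodP/asboolP.
  rewrite /stable_rep_inv /stable_rep_map /=.
  rewrite -[X in existT _ j X](_ : loopn_map R _ (pmap_comp (g _) (f _)) a = _);
    last by rewrite loopn_map_comp.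
  rewrite -[a in X in clos_refl_sym_trans _ _ _ X]/(pmap_id _ a) -loopn_map_id.
  exact: stable_homotopic.
case: (repr x) => j a; rewrite invE stable_pi_mapE; apply/eqmodP/asboolP.
rewrite /stable_rep_inv /stable_rep_map /=.
rewrite -[X in existT _ j X](_ : loopn_map R _ (pmap_comp (f _) (g _)) a = _);
  last by rewrite loopn_map_comp.
rewrite -[a in X in clos_refl_sym_trans _ _ _ X]/(pmap_id _ a) -loopn_map_id.
exact: stable_homotopic.
Qed.

End Indices.

Lemma level_equivalence_weak_equivalence : weak_equivalence f.
Proof. by move=> k; exact: stable_pi_map_bijective. Qed.

End Level_equivalences.

(** * Threads as subsets, and motions of threads *)

Section Images.
Variables (R : realType) (k N : nat).
Implicit Types (x y : Phi R k N) (phi psi : conf_paths R k N).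

(* An element of the limit is determined by its image, which may have
   infinitely many components. *)
Definition Phi_image x : set (R * slab R k N) :=
  [set p | exists r, conf_box r p /\ im (stage_repr (Phi_proj r x)) p].

Lemma conf_box_le r s : (r <= s)%N ->
  @conf_box R k N r `<=` @conf_box R k N s.
Proof.
move=> rs; have le2 : r%:R / 2 <= s%:R / 2 :> R.
  by rewrite ler_pM2r ?invr_gt0 ?ler_nat.
move=> p [p1 p2]; split=> [|i ik]; first exact: le_trans le2.
exact: le_trans (p2 i ik) le2.
Qed.

Lemma agreeP r phi psi :
  agree r phi psi <-> forall p, conf_box r p -> im phi p <-> im psi p.
Proof.
split=> [/asboolP e p rp|e].
  have : (im phi `&` conf_box r) p <-> (im psi `&` conf_box r) p by rewrite e.
  by move=> [h h']; split=> ip; [case: h|case: h'].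
by apply/asboolP/seteqP; split=> p [ip rp]; split=> //; apply/(e p rp).
Qed.

(** Representatives at two stages agree on the smaller box by the thread condition, so each of them
    computes the image there. *)
Lemma Phi_imageE x r phi p : stage_class r phi = Phi_proj r x ->
  conf_box r p -> Phi_image x p <-> im phi p.
Proof.
have le_im s t psi chi : (s <= t)%N -> stage_class s psi = Phi_proj s x ->
    stage_class t chi = Phi_proj t x -> conf_box s p -> im psi p <-> im chi p.
  move=> st psix chix sp; have := Phi_projP x st.
  rewrite -psix -chix stage_proj_class// => /esym/stage_classP/agreeP; exact.
move=> phix rp; split=> [[s [sp]]|ip]; last first.
  exists r; split=> //.
  exact: (le_im r r _ phi (leqnn r) (stage_reprK _) phix rp).2.
have [rs|/ltnW sr] := leqP r s.
  exact: (le_im r s phi _ rs phix (stage_reprK _) rp).2.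
exact: (le_im s r _ phi sr (stage_reprK _) phix sp).1.
Qed.

Lemma Phi_image_repr x r p : conf_box r p ->
  Phi_image x p <-> im (stage_repr (Phi_proj r x)) p.
Proof. by apply: Phi_imageE; exact: stage_reprK. Qed.

(** At each stage, equal images give representatives that agree on the box. Elements of the limit
    are compared below through this injectivity. *)
Lemma Phi_imageP x y : Phi_image x = Phi_image y -> x = y.
Proof.
move=> xy; apply: PhiP => r.
rewrite -[LHS]stage_reprK -[RHS]stage_reprK; apply/stage_classP/agreeP => p rp.
by rewrite -!Phi_image_repr// xy.
Qed.

Lemma Phi_image_point : Phi_image point = set0.
Proof.
rewrite -subset0 => p [r [rp ip]].
have /(Phi_imageE (x := point)) : stage_class r (empty_path R k N) = Phi_proj r point.
  by [].
move=> /(_ _ rp)[+ _]; rewrite im_empty_path; apply.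
by exists r.
Qed.

Lemma conf_box_exists (p : R * slab R k N) : exists r, conf_box r p.
Proof.
pose b : R := `|p.1| + `|slab_val p.2|.
(* The box of size r has half-side r / 2, hence the factor 2. *)
exists (Num.bound (2 * b)).
have b0 : 0 <= b by rewrite addr_ge0.
have lb : b <= (Num.bound (2 * b))%:R / 2.
  by rewrite ler_pdivlMr// mulrC ltW// archi_boundP// mulr_ge0.
split=> [|i _]; apply: le_trans lb; first by rewrite lerDl.
apply: ler_wpDl => //; rewrite /Num.Def.normr /= mx_normrE.
exact: (le_bigmax _ (fun ij => `|slab_val p.2 ij.1 ij.2|) (ord0, i)).
Qed.

End Images.

(** * Motions of the limit that pull images back along self-maps of space-time *)

Section Motions.
Variables (R : realType) (k N : nat).
(** [G r t] may depend on the stage r: only its effect inside the box of size r matters, and there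
    it is pullback along [J t], the same for all stages. *)
Variable G : nat -> R -> conf_paths R k N -> conf_paths R k N.
Variable J : R -> R * slab R k N -> R * slab R k N.
Hypothesis G_continuous : forall r n, continuous
  (fun xt : conf_path R n (slab R k N) * R =>
     stage_class r (G r xt.2 (existT _ n xt.1))).
Hypothesis J_box : forall r t p, conf_box r p -> conf_box r (J t p).
Hypothesis im_G : forall r t phi p, conf_box r p ->
  im (G r t phi) p <-> im phi (J t p).

(** [J t] keeps points of the box inside it, so the result in the box depends only on the input in
    the box. *)
Lemma agree_motion r t phi psi : agree r phi psi -> agree r (G r t phi) (G r t psi).
Proof.
move=> /agreeP e; apply/agreeP => p rp; rewrite !im_G//.
exact/e/J_box.
Qed.

Definition stage_motion r (t : R) (x : Phi_stage R k N r) : Phi_stage R k N r :=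
  stage_class r (G r t (stage_repr x)).

Lemma stage_motion_class r t phi :
  stage_motion t (stage_class r phi) = stage_class r (G r t phi).
Proof. by apply/stage_classP/agree_motion/stage_classP; exact: stage_reprK. Qed.

Lemma stage_motion_proj r s t (x : Phi R k N) : (r <= s)%N ->
  stage_proj r (stage_motion t (Phi_proj s x)) = stage_motion t (Phi_proj r x).
Proof.
move=> rs; rewrite stage_proj_class//; apply/stage_classP/agreeP => p rp.
have Jp := J_box t rp.
rewrite !im_G//; last exact: conf_box_le rp.
by rewrite -!Phi_image_repr//; exact: conf_box_le Jp.
Qed.

Definition Phi_motion (t : R) (x : Phi R k N) : Phi R k N :=
  Thread (fun r s => @stage_motion_proj r s t x).

Lemma Phi_image_motion t x : Phi_image (Phi_motion t x) = J t @^-1` Phi_image x.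
Proof.
apply/seteqP; split=> p; have [r rp] := conf_box_exists p;
  rewrite (Phi_imageE (r := r) (phi := G r t (stage_repr (Phi_proj r x))))//;
  by rewrite im_G// -Phi_image_repr//; exact: J_box.
Qed.

(** This is the argument that a quotient map times the locally compact line is again a quotient map:
    curry, descend along the quotient, uncurry. *)
Lemma stage_motion_continuous r :
  continuous (fun xt : Phi_stage R k N r * R => stage_motion xt.2 xt.1).
Proof.
pose g (phi : conf_paths R k N) (t : R) : Phi_stage R k N r :=
  stage_class r (G r t phi).
pose H (x : Phi_stage R k N r) : {compact-open, R -> Phi_stage R k N r} :=
  fun t => stage_motion t x.
have HE : H \o stage_class r = g.
  by apply/funext => x; apply/funext => t; exact: stage_motion_class.
have cH : continuous H.
  apply/quotient_continuous; rewrite -/(stage_class r) HE.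
  by case=> n phi; exact: (continuous_curry (@G_continuous r n)).1 phi.
have cHx x : continuous (H x).
  have -> : H x = g (stage_repr x) by rewrite -HE /= stage_reprK.
  case: (stage_repr x) => n phi.
  exact: (continuous_curry (@G_continuous r n)).2 phi.
have -> : (fun xt : Phi_stage R k N r * R => stage_motion xt.2 xt.1) =
    uncurry H by apply/funext => -[].
exact: (continuous_uncurry (@locally_compactR R) (@Rhausdorff R) cH cHx).
Qed.

Lemma Phi_motion_continuous :
  continuous (fun xt : Phi R k N * R => Phi_motion xt.2 xt.1).
Proof.
apply: continuous_Phi => r.
apply: (continuousT_comp (f := fun xt => (Phi_proj r xt.1, xt.2)))
  (@stage_motion_continuous r).
apply: pair_continuous; last exact: snd_continuous.
by apply: continuousT_comp; [exact: fst_continuous|exact: Phi_proj_continuous].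
Qed.

End Motions.

(** * Open conditions on the configuration at time 0 *)

Section Slices.
Variables (R : realType) (k N : nat).
Local Notation X := (slab R k N).

Definition Phi_slice (x : Phi R k N) : set X := [set y | Phi_image x (0, y)].

(** A condition visible in the box of size r descends to stage r. Openness is then traced back
    through the quotient, the disjoint union over n, evaluation at time 0 and the quotient by
    permutations. *)
Lemma open_slice (Q : set X -> Prop) (r : nat) :
  (forall A, Q A <-> Q (A `&` [set y | conf_box r (0, y)])) ->
  (forall n, open [set c : ordered_conf n X | Q (range (conf_point c))]) ->
  open [set x | Q (Phi_slice x)].
Proof.
move=> Qr oQ.
pose sl (phi : conf_paths R k N) : set X := [set y | im phi (0, y)].
have slE (A B : set X) : (forall y, conf_box r (0, y) -> A y <-> B y) -> Q A <-> Q B.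
  move=> AB; rewrite Qr [Q B]Qr (_ : A `&` _ = B `&` [set y | conf_box r (0, y)])//.
  by apply/seteqP; split=> y [Ay ry]; split=> //; apply/(AB y ry).
rewrite (_ : [set x | _] =
    Phi_proj r @^-1` [set z : Phi_stage R k N r | Q (sl (stage_repr z))]); last first.
  apply/seteqP; split=> x /=; rewrite (slE _ (sl (stage_repr (Phi_proj r x))))//;
    by move=> y ry; exact: Phi_image_repr.
apply: open_comp; first by move=> x _; exact: Phi_proj_continuous.
rewrite /open /= /quotient_open (_ : _ @^-1` _ = [set phi | Q (sl phi)]); last first.
  apply/seteqP; split=> phi /=; rewrite (slE _ (sl phi))// => y ry;
    have /stage_classP/agreeP := stage_reprK (stage_class r phi); exact.
apply/sigT_openP => n.
rewrite (_ : _ @^-1` _ = (fun phi : conf_path R n X => (path_fun phi 0).2) @^-1`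
    [set c | Q (uconf_set c)]); last first.
  apply/seteqP; split=> phi; rewrite /= /sl /im /path_image /= (_ : [set y | _] =
    uconf_set (path_fun phi 0).2) //; apply/seteqP; split=> y /=;
    by [case=> _ <-|exists 0].
apply: open_comp => [phi _|].
  apply: (continuousT_comp (f := fun phi : conf_path R n X => path_fun phi 0)
    (g := snd)); last exact: snd_continuous.
  apply: (continuousT_comp (f := fun phi : conf_path R n X => (phi, 0 : R)))
    (@eval_path_continuous R n X).
  apply: pair_continuous; last exact: cst_continuous.
  by move=> psi; exact: cvg_id.
rewrite /open /= /quotient_open.
rewrite (_ : _ @^-1` _ = [set c | Q (range (conf_point c))]) ?oQ//.
by apply/seteqP; split=> c /=; rewrite uconf_set_pi.
Qed.

End Slices.

(** * Contraction of the time direction *)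

Section Time_contraction.
Variables (R : realType) (k N : nat).

(** The value is 1 at 0 and 0 at 1, and stays in [[0, 1]] for every real t, as homotopy parameters
    run over the line. *)
Definition contraction_factor (t : R) : R := Num.max 0 (1 - `|t|).

Lemma contraction_factor_ge0 t : 0 <= contraction_factor t.
Proof. by rewrite /contraction_factor le_max lexx. Qed.

Lemma contraction_factor_le1 t : contraction_factor t <= 1.
Proof. by rewrite /contraction_factor ge_max ler01 gerBl normr_ge0. Qed.

Lemma contraction_factor_continuous : continuous contraction_factor.
Proof.
move=> t; apply: (@continuous_max R R (cst 0) (fun t => 1 - `|t|)).
  exact: cvg_cst.
apply: cvgB; first exact: cvg_cst.
exact: norm_continuous.
Qed.

Lemma contracted_path_continuous n (t : R) (phi : conf_path R n (slab R k N)) :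
  continuous (fun s => (s, (path_fun phi (contraction_factor t * s)).2)).
Proof.
apply: pair_continuous; first by move=> s; exact: cvg_id.
apply: (continuousT_comp (f := fun s => path_fun phi (contraction_factor t * s))
  (g := snd)); last exact: snd_continuous.
apply: (continuousT_comp (f := fun s => contraction_factor t * s)).
  by move=> s; exact: mulrl_continuous.
exact: path_fun_continuous.
Qed.

Definition contracted_path n (t : R) (phi : conf_path R n (slab R k N)) :
    conf_path R n (slab R k N) :=
  ConfPath (@contracted_path_continuous n t phi) (fun=> erefl).

Definition paths_contract (t : R) (phi : conf_paths R k N) : conf_paths R k N :=
  existT _ (projT1 phi) (contracted_path t (projT2 phi)).

Lemma paths_contract_continuous r n : continuous
  (fun xt : conf_path R n (slab R k N) * R =>
     stage_class r (paths_contract xt.2 (existT _ n xt.1))).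
Proof.
rewrite (_ : (fun xt => _) = stage_class r \o
    existT (fun n => conf_path R n (slab R k N)) n \o
    (fun xt => contracted_path xt.2 xt.1)) //.
apply: continuousT_comp; last first.
  apply: continuousT_comp; first exact: existT_continuous.
  exact: pi_continuous.
apply: continuous_comp_initial.
pose g (p : conf_path R n (slab R k N) * R * R) : (R * uconf n (slab R k N))%type :=
  (p.2, (path_fun p.1.1 (contraction_factor p.1.2 * p.2)).2).
suff cg : continuous g by exact: (continuous_curry cg).1.
apply: pair_continuous; first exact: snd_continuous.
apply: (continuousT_comp (f := fun p : conf_path R n (slab R k N) * R * R =>
  path_fun p.1.1 (contraction_factor p.1.2 * p.2)) (g := snd));
  last exact: snd_continuous.
apply: (continuousT_comp (f := fun p : conf_path R n (slab R k N) * R * R =>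
  (p.1.1, contraction_factor p.1.2 * p.2))) (@eval_path_continuous R n _).
apply: pair_continuous.
  apply: (continuousT_comp (f := fst) (g := fst)); exact: fst_continuous.
move=> p; apply: cvgM; last exact: cvg_snd.
apply: (continuous_comp (f := fun p : conf_path R n (slab R k N) * R * R => p.1.2));
  last exact: contraction_factor_continuous.
by apply: (continuousT_comp (f := fst) (g := snd));
  [exact: fst_continuous|exact: snd_continuous].
Qed.

Definition time_scale (t : R) (p : R * slab R k N) : R * slab R k N :=
  (contraction_factor t * p.1, p.2).

Lemma time_scale_box r t p : conf_box r p -> conf_box r (time_scale t p).
Proof.
move=> [p1 p2]; split=> //=; rewrite normrM.
apply: le_trans p1; rewrite ger0_norm ?contraction_factor_ge0//.
by rewrite ler_piMl ?contraction_factor_le1.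
Qed.

Lemma im_paths_contract r t phi p : conf_box r p ->
  im (paths_contract t phi) p <-> im phi (time_scale t p).
Proof.
move=> _; split=> [[_ <- ?]|[_ <- ?]]; first by exists (contraction_factor t * p.1).
by exists p.1.
Qed.

Definition time_contract : R -> Phi R k N -> Phi R k N :=
  Phi_motion time_scale_box im_paths_contract.

Lemma time_contract_continuous :
  continuous (fun xt : Phi R k N * R => time_contract xt.2 xt.1).
Proof. exact/Phi_motion_continuous/(fun=> paths_contract_continuous). Qed.

Lemma Phi_image_time_contract t x :
  Phi_image (time_contract t x) = time_scale t @^-1` Phi_image x.
Proof. exact: Phi_image_motion. Qed.

End Time_contraction.

(** * Pullback along embeddings of the space onto open balls *)

Section Expansion.
Variables (R : realType) (N : nat).
Local Notation X := (slab R N N).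

Definition slab_of (v : 'rV[R]_N) : X :=
  exist (fun v => v \in @slab_set R N N) v (slab_set_full v).

Lemma slab_valK : cancel (@slab_val R N N) slab_of.
Proof. by move=> x; exact: val_inj. Qed.

Lemma slab_of_continuous : continuous slab_of.
Proof. by apply: continuous_comp_initial => v; exact: cvg_id. Qed.

Lemma slab_val_continuous : continuous (@slab_val R N N).
Proof. exact: initial_continuous. Qed.

Lemma norm_conf_box r t (x : X) : conf_box r (t, x) -> `|slab_val x| <= r%:R.
Proof.
move=> [_ /= xr]; rewrite [`|_|]/Num.Def.normr /= mx_normrE.
apply: bigmax_le => // -[i j] _ /=; rewrite ord1.
by apply: le_trans (xr j (ltn_ord j)) _; rewrite ler_pdivrMr// ler_peMr ?ler1n.
Qed.

(* [expand r u] restricts on the box of size r to the inverse of the embedding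
   [y |-> y / (1 + |u| |y|)], and maps the points without preimage in that box
   out of it. *)
Definition expand_denom (r : nat) (u : R) (v : 'rV[R]_N) : R :=
  Num.max (1 - `|u| * `|v|) (1 + `|u| * r%:R)^-1.

Definition expand (r : nat) (u : R) (x : X) : X :=
  slab_of ((expand_denom r u (slab_val x))^-1 *: slab_val x).

Definition shrink (u : R) (x : X) : X :=
  slab_of ((1 + `|u| * `|slab_val x|)^-1 *: slab_val x).

(** The cut-off [(1 + |u| r)^-1] is the value of [1 - |u| |v|] at the norm [r / (1 + |u| r)], to
    which vectors of norm r are shrunk. It keeps the denominator positive where the true inverse
    blows up. *)
Lemma expand_denom_gt0 r u v : 0 < expand_denom r u v.
Proof. by rewrite lt_max invr_gt0 [X in _ || X]ltr_pwDl ?mulr_ge0 ?orbT. Qed.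

(** The norm of the image increases strictly with that of the vector, as the denominator does not
    increase. Equal images thus come from equal norms, hence equal denominators, which cancel. *)
Lemma expand_inj r u : injective (expand r u).
Proof.
have norm_lt (v w : 'rV[R]_N) : `|v| < `|w| ->
    `|v| / expand_denom r u v < `|w| / expand_denom r u w.
  move=> vw; apply: (@le_lt_trans _ _ (`|v| / expand_denom r u w)).
    rewrite ler_wpM2l// lef_pV2 ?posrE ?expand_denom_gt0//.
    rewrite /expand_denom ge_max !le_max lexx orbT andbT; apply/orP; left.
    by rewrite lerD2l lerN2 ler_wpM2l// ltW.
  by rewrite ltr_pM2r ?invr_gt0 ?expand_denom_gt0.
move=> x y xyE.
have e : (expand_denom r u (slab_val x))^-1 *: slab_val x =
    (expand_denom r u (slab_val y))^-1 *: slab_val y.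
  by have := congr1 (@slab_val R N N) xyE.
have n (v : 'rV[R]_N) : `|(expand_denom r u v)^-1 *: v| = `|v| / expand_denom r u v.
  by rewrite normrZ mulrC normfV gtr0_norm ?expand_denom_gt0.
have xy : `|slab_val x| = `|slab_val y|.
  have := congr1 Num.norm e; rewrite !n.
  case: (ltgtP `|slab_val x| `|slab_val y|) => // /norm_lt h e';
    by rewrite e' ltxx in h.
apply/val_inj; move: e; rewrite /expand_denom xy => /scalerI; apply=> //.
by rewrite invr_eq0 gt_eqF// (expand_denom_gt0 r u (slab_val y)).
Qed.

Lemma expand_continuous r : continuous (fun xu : X * R => expand r xu.2 xu.1).
Proof.
have cx : continuous (fun xu : X * R => slab_val xu.1).
  by apply: continuousT_comp; [exact: fst_continuous|exact: slab_val_continuous].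
have cu : continuous (fun xu : X * R => `|xu.2|).
  by apply: continuousT_comp; [exact: snd_continuous|exact: norm_continuous].
apply: continuousT_comp; last exact: slab_of_continuous.
move=> xu; apply: cvgZ; last exact: cx.
apply: cvgV; first by rewrite gt_eqF ?expand_denom_gt0.
apply: (@continuous_max R _ (fun xu : X * R => 1 - `|xu.2| * `|slab_val xu.1|)
  (fun xu => (1 + `|xu.2| * r%:R)^-1)).
- apply: cvgB; first exact: cvg_cst.
  apply: cvgM; first exact: cu.
  apply: (continuous_comp (f := fun xu : X * R => slab_val xu.1)); first exact: cx.
  exact: norm_continuous.
- apply: cvgV; first by rewrite gt_eqF// ltr_pwDl ?mulr_ge0.
  apply: cvgD; first exact: cvg_cst.
  apply: cvgM; [exact: cu|exact: cvg_cst].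
Qed.

Lemma expandE r u t (x y : X) : conf_box r (t, y) ->
  expand r u x = y <-> x = shrink u y.
Proof.
move=> /norm_conf_box yr; have u0 := normr_ge0 u.
have one_gt0 a : 0 <= a -> 0 < 1 + `|u| * a by move=> a0; rewrite ltr_pwDl ?mulr_ge0.
have D0 := expand_denom_gt0 r u (slab_val x).
split=> [xy|->].
- have yE : (expand_denom r u (slab_val x))^-1 *: slab_val x = slab_val y.
    by rewrite -xy.
  have ny : `|slab_val y| = `|slab_val x| / expand_denom r u (slab_val x).
    by rewrite -yE normrZ mulrC normfV gtr0_norm.
  suff DE : expand_denom r u (slab_val x) = (1 + `|u| * `|slab_val y|)^-1.
    by apply/val_inj; rewrite /= -DE -yE scalerA divff ?scale1r// gt_eqF.
  have nx : `|slab_val x| = expand_denom r u (slab_val x) * `|slab_val y|.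
    by rewrite ny mulrC divfK// gt_eqF.
  have [le|lt] := leP (1 + `|u| * r%:R)^-1 (1 - `|u| * `|slab_val x|).
  + have DE : expand_denom r u (slab_val x) = 1 - `|u| * `|slab_val x|.
      by apply/max_idPl.
    (* With D the denominator, the claim becomes [D (1 + |u| |y|) = 1], where [|x| = D |y|] and
       [D = 1 - |u| |x|]. *)
    apply: (mulIf (lt0r_neq0 (one_gt0 _ (normr_ge0 (slab_val y))))).
    rewrite mulVf ?gt_eqF ?one_gt0// mulrDr mulr1 mulrCA -nx.
    by rewrite DE subrK.
  (* An active cut-off forces the norm of y above r, which the box excludes. *)
  + have DE : expand_denom r u (slab_val x) = (1 + `|u| * r%:R)^-1.
      by apply/max_idPr/ltW.
    exfalso; move: lt; rewrite nx DE ltrBlDr => lt.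
    have : 1 < (1 + `|u| * `|slab_val y|) / (1 + `|u| * r%:R).
      by rewrite mulrDl mul1r -mulrA [`|slab_val y| / _]mulrC.
    by rewrite ltr_pdivlMr ?one_gt0// mul1r ltrD2l ltNge ler_wpM2l.
- set d := 1 + `|u| * `|slab_val y|; have d0 : 0 < d by exact: one_gt0.
  apply/val_inj; rewrite /= -[slab_val _]/(d^-1 *: slab_val y).
  have -> : expand_denom r u (d^-1 *: slab_val y) = d^-1.
    have dE : 1 - `|u| * `|d^-1 *: slab_val y| = d^-1.
      rewrite normrZ normfV (gtr0_norm d0) mulrCA.
      have -> : `|u| * `|slab_val y| = d - 1 by rewrite /d addrAC subrr add0r.
      by rewrite mulrBr mulVf ?gt_eqF// mulr1 opprB addrC subrK.
    rewrite /expand_denom dE; apply/max_idPl.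
    by rewrite lef_pV2 ?posrE ?one_gt0// lerD2l ler_wpM2l.
  by rewrite invrK scalerA divff ?scale1r// gt_eqF.
Qed.

Definition paths_expand (r : nat) (u : R) (phi : conf_paths R N N) :
    conf_paths R N N :=
  existT (fun n => conf_path R n X) (projT1 phi)
    (path_move (@expand_inj r) (@expand_continuous r) u (projT2 phi)).

Lemma paths_expand_continuous r n : continuous
  (fun xu : conf_path R n X * R =>
     stage_class r (paths_expand r xu.2 (existT _ n xu.1))).
Proof.
rewrite (_ : (fun xu => _) = stage_class r \o
    existT (fun n => conf_path R n X) n \o
    (fun xu => path_move (@expand_inj r) (@expand_continuous r) xu.2 xu.1)) //.
apply: continuousT_comp; first exact: path_move_continuous.
apply: continuousT_comp; first exact: existT_continuous.
exact: pi_continuous.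
Qed.

Definition space_shrink (u : R) (p : R * X) : R * X := (p.1, shrink u p.2).

Lemma space_shrink_box r u p : conf_box r p -> conf_box r (space_shrink u p).
Proof.
move=> [p1 p2]; split=> //= i iN; apply: le_trans (p2 i iN).
rewrite mxE normrM normfV [`|1 + _|]ger0_norm ?addr_ge0 ?mulr_ge0//.
by rewrite ler_piMl// invf_le1 ?lerDl ?mulr_ge0// ltr_pwDl ?mulr_ge0.
Qed.

(** A finite path keeps its number of points, so those outside the image of [shrink u] are sent out
    of the box; inside the box, pushing along [expand] is pulling back along [shrink]. *)
Lemma im_paths_expand r u phi p : conf_box r p ->
  im (paths_expand r u phi) p <-> im phi (space_shrink u p).
Proof.
case: p => t y rp; rewrite /im path_image_move; split.
  by move=> [[s x] px [<- /= xy]]; rewrite /space_shrink /= -((expandE u x rp).1 xy).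
move=> px; exists (t, shrink u y) => //=; congr pair.
exact/(expandE u _ rp).
Qed.

Definition Phi_expand : R -> Phi R N N -> Phi R N N :=
  Phi_motion space_shrink_box im_paths_expand.

Lemma Phi_expand_continuous :
  continuous (fun xu : Phi R N N * R => Phi_expand xu.2 xu.1).
Proof. exact/Phi_motion_continuous/paths_expand_continuous. Qed.

Lemma Phi_image_expand u x :
  Phi_image (Phi_expand u x) = space_shrink u @^-1` Phi_image x.
Proof. exact: Phi_image_motion. Qed.

(** In a box that contains both points, [expand] is a left inverse. *)
Lemma shrink_inj u : injective (shrink u).
Proof.
move=> x y xy.
have [r xr] := conf_box_exists (0 : R, x); have [s ys] := conf_box_exists (0 : R, y).
have /(expandE u (shrink u y)) xE := conf_box_le (leq_maxl r s) xr.
have /(expandE u (shrink u y)) yE := conf_box_le (leq_maxr r s) ys.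
by rewrite -(xE.2 (esym xy)) (yE.2 erefl).
Qed.

(** The strict bound puts the image into the open isolating ball when u is the inverse of its
    radius. *)
Lemma norm_shrink u (x : X) : u != 0 -> `|slab_val (shrink u x)| < `|u|^-1.
Proof.
move=> u0; have d0 : 0 < 1 + `|u| * `|slab_val x| by rewrite ltr_pwDl ?mulr_ge0.
rewrite normrZ normfV gtr0_norm// ltr_pdivrMl// ltr_pdivlMr ?normr_gt0//.
by rewrite mulrC ltrDr.
Qed.

Lemma shrink0 (x : X) : shrink 0 x = x.
Proof. by rewrite /shrink normr0 mul0r addr0 invr1 scale1r slab_valK. Qed.

End Expansion.

(** * The inclusion of the sphere *)

Lemma conf_point_continuous n (X : topologicalType) (i : 'I_n) :
  continuous (fun c : ordered_conf n X => conf_point c i).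
Proof.
apply: (@continuousT_comp _ {ptws 'I_n -> X} _ (@conf_point n X) (fun f => f i)).
  exact: initial_continuous.
exact: proj_continuous.
Qed.

Section Sphere_inclusion.
Variables (R : realType) (N : nat).
Local Notation X := (slab R N N).

Lemma slab_conf_continuous n (i : 'I_n) :
  continuous (fun c : ordered_conf n X => slab_val (conf_point c i)).
Proof.
apply: continuousT_comp; first exact: conf_point_continuous.
exact: slab_val_continuous.
Qed.

Lemma conf_box_norm r (v : 'rV[R]_N) : `|v| <= r%:R / 2 ->
  conf_box r (0, slab_of v).
Proof.
move=> vr; split=> [|i _] /=; first by rewrite normr0; exact: le_trans vr.
apply: le_trans vr; rewrite [leRHS]/Num.Def.normr /= mx_normrE.
exact: (le_bigmax _ (fun ij => `|v ij.1 ij.2|) (ord0, i)).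
Qed.

Lemma slab_of_inj : injective (@slab_of R N).
Proof. by move=> v w vw; have := congr1 (@slab_val R N N) vw. Qed.

Definition singleton_conf (v : 'rV[R]_N) : ordered_conf 1 X :=
  @OrderedConf 1 X (fun=> slab_of v) (fun i j _ => etrans (ord1 i) (esym (ord1 j))).

Lemma singleton_conf_continuous : continuous singleton_conf.
Proof.
apply: continuous_comp_initial; apply: ptws_continuous => i.
exact: slab_of_continuous.
Qed.

Definition constant_path (v : 'rV[R]_N) : conf_path R 1 X :=
  @ConfPath R 1 X (fun t => (t, \pi_(uconf 1 X) (singleton_conf v)))
    (pair_continuous (fun t => @cvg_id _ (nbhs t)) (@cst_continuous _ _ _))
    (fun=> erefl).

Lemma constant_path_continuous : continuous constant_path.
Proof.
apply: continuous_comp_initial.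
pose g (vt : 'rV[R]_N * R) : (R * uconf 1 X)%type :=
  (vt.2, \pi_(uconf 1 X) (singleton_conf vt.1)).
suff cg : continuous g by exact: (continuous_curry cg).1.
apply: pair_continuous; first exact: snd_continuous.
apply: (continuousT_comp (f := singleton_conf \o fst)); last exact: pi_continuous.
by apply: continuousT_comp; [exact: fst_continuous|exact: singleton_conf_continuous].
Qed.

Definition constant_paths (v : 'rV[R]_N) : conf_paths R N N :=
  existT (fun n => conf_path R n X) 1 (constant_path v).

Lemma im_constant_paths v p : im (constant_paths v) p <-> p.2 = slab_of v.
Proof.
split=> [[t _]|pv].
  by rewrite uconf_set_pi => -[i _ <-].
by exists p.1 => //; rewrite uconf_set_pi; exists ord0.
Qed.

Definition sphere_Phi_fun (x : sphere R N) : Phi R N N :=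
  if x is Some v then
    Thread (fun r s => @stage_proj_class R N N r s (constant_paths v))
  else point.

Lemma sphere_Phi_continuous : continuous sphere_Phi_fun.
Proof.
apply: continuous_Phi => r [v|].
- have c : continuous (fun v => Phi_proj r (sphere_Phi_fun (Some v))).
    apply: (continuousT_comp constant_path_continuous
      (g := stage_class r \o existT (fun n => conf_path R n X) 1)).
    by apply: continuousT_comp; [exact: existT_continuous|exact: pi_continuous].
  by move=> U /(c v).
- move=> U /nbhs_singleton U0.
  (* For v outside this compact cube the constant path misses the box of size r, hence has the class
     of the empty path. *)
  pose K : set 'rV[R]_N :=
    [set v | forall i, [set` `[- (r%:R / 2), r%:R / 2]] (v ord0 i)].
  have cK : compact K.
    by apply: (@rV_compact _ N (fun=> [set` _])) => _; exact: segment_compact.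
  exists K; first by split=> //; exact: compact_closed (@norm_hausdorff _ _) cK.
  move=> _ [[v vK <-]|->] //=.
  rewrite (_ : Phi_proj r _ = Phi_proj r point) //.
  apply/stage_classP/agreeP => p [_ p2]; rewrite im_empty_path.
  split=> // /im_constant_paths pv; apply: vK => i /=.
  by rewrite in_itv /= -ler_norml; have := p2 i (ltn_ord i); rewrite pv.
Qed.

Definition sphere_Phi : pmap (sphere R N) (Phi R N N) :=
  @Pmap _ _ sphere_Phi_fun sphere_Phi_continuous erefl.

Lemma Phi_image_sphere x p :
  Phi_image (sphere_Phi x) p <-> if x is Some v then p.2 = slab_of v else False.
Proof.
case: x => [v|]; last by rewrite Phi_image_point.
have [r rp] := conf_box_exists p.
by rewrite (Phi_imageE (r := r) (phi := constant_paths v))// im_constant_paths.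
Qed.

Lemma sphere_Phi_inj : injective sphere_Phi.
Proof.
move=> x y xy.
have e p := iff_trans (iff_sym (Phi_image_sphere x p))
  (iff_trans (eq_ind _ (fun z => _ <-> Phi_image z p) (iff_refl _) _ xy)
    (Phi_image_sphere y p)).
case: x y {xy} e => [v|] [w|] // e.
- congr Some; apply: slab_of_inj; exact: (e (0, slab_of v)).1 erefl.
- by have := (e (0, slab_of v)).1 erefl.
- by have := (e (0, slab_of w)).2 erefl.
Qed.

(** An image that is constant in time with at most one point belongs to a constant path or to the
    empty path, according to whether [P] is inhabited. *)
Lemma sphere_Phi_range z (P : set X) :
  (forall p, Phi_image z p <-> P p.2) -> (forall x y, P x -> P y -> x = y) ->
  exists x, sphere_Phi x = z.
Proof.
move=> zP P1; have [[y Py]|nP] := pselect (exists y, P y).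
  exists (Some (slab_val y)); apply: Phi_imageP; apply/seteqP; split=> p.
    by move=> /Phi_image_sphere; rewrite slab_valK => py; apply/zP; rewrite py.
  by move=> /zP Pp; apply/Phi_image_sphere; rewrite slab_valK; exact: P1.
exists None; apply: Phi_imageP; apply/seteqP; split=> p.
  by move=> /Phi_image_sphere.
by move=> /zP Pp; case: nP; exists p.2.
Qed.

(** A point of a configuration stays in an open set under small moves; the bound r / 2 confines the
    condition to one box. *)
Lemma open_meets_slice (O : set 'rV[R]_N) r : open O ->
  (forall v, O v -> `|v| <= r%:R / 2) ->
  open [set x : Phi R N N | exists v, O v /\ Phi_slice x (slab_of v)].
Proof.
move=> oO Or; apply: (@open_slice R N N (fun A => exists v, O v /\ A (slab_of v)) r).
  move=> A; split=> [[v [Ov Av]]|[v [Ov [Av _]]]]; exists v; split=> //.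
  by split=> //; exact/conf_box_norm/Or.
move=> n; rewrite openE => c [v [Ov [i _ civ]]].
have : nbhs c ((fun c : ordered_conf n X => slab_val (conf_point c i)) @^-1` O).
  by apply: slab_conf_continuous; rewrite civ; exact: open_nbhs_nbhs.
apply: filterS => d Od; exists (slab_val (conf_point d i)).
by split=> //; exists i => //; rewrite slab_valK.
Qed.

(** Each of the finitely many points of a representative stays off a closed set under small
    moves. *)
Lemma open_misses_slice (K : set 'rV[R]_N) r : closed K ->
  (forall v, K v -> `|v| <= r%:R / 2) ->
  open [set x : Phi R N N | forall v, K v -> ~ Phi_slice x (slab_of v)].
Proof.
move=> cK Kr; apply: (@open_slice R N N (fun A => forall v, K v -> ~ A (slab_of v)) r).
  move=> A; split=> [AK v Kv [Av _]|AK v Kv Av]; apply: (AK v) => //.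
  by split=> //; exact/conf_box_norm/Kr.
move=> n; rewrite openE => c cK'.
have : \forall d \near c, forall i, (~` K) (slab_val (conf_point d i)).
  apply: (@filter_forall _ _ (fun (i : 'I_n) (d : ordered_conf n X) =>
    (~` K) (slab_val (conf_point d i))) (nbhs c)) => i.
  apply: slab_conf_continuous; apply: open_nbhs_nbhs.
  split; first exact: closed_openC.
  by move=> /cK'; apply; exists i => //; rewrite slab_valK.
by apply: filterS => d dK v Kv [i _ div]; apply: (dK i); rewrite div.
Qed.

(** The topology of the sphere is detected at time 0: closeness to v by meeting a bounded open set
    around v, closeness to infinity by missing a compact set. *)
Lemma sphere_Phi_embedding (T : topologicalType) (G : T -> sphere R N) :
  continuous (sphere_Phi \o G) -> continuous G.
Proof.
move=> cG t U; rewrite /continuous_at; case Gt : (G t) => [v|].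
- move=> /= vU; have : nbhs v (Some @^-1` U : set 'rV[R]_N) by [].
  rewrite nbhsE => -[O [oO Ov] OU].
  pose r := (Num.bound (2 * `|v|)).
  have vr : `|v| < r%:R / 2 by rewrite ltr_pdivlMr// mulrC archi_boundP// mulr_ge0.
  pose B : set 'rV[R]_N := O `&` [set w | `|w| < r%:R / 2].
  have oB : open B.
    apply: openI => //.
    rewrite -[X in open X]/((fun w : 'rV[R]_N => `|w|) @^-1`
      [set a : R | a < r%:R / 2]).
    by apply: open_comp => [w _|]; [exact: norm_continuous|exact: open_lt].
  have Br w : B w -> `|w| <= r%:R / 2 by move=> [_ /ltW].
  have : nbhs (sphere_Phi (G t))
      [set x : Phi R N N | exists w, B w /\ Phi_slice x (slab_of w)].
    apply: open_nbhs_nbhs; split; first exact: open_meets_slice Br.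
    by rewrite Gt; exists v; split=> //; exact/Phi_image_sphere.
  move=> /cG; apply: (@filterS _ (nbhs t)) => s [w [[Ow _] /Phi_image_sphere]].
  rewrite /=; case: (G s) => //= w' ww'; apply: OU.
  by rewrite -(slab_of_inj ww').
- move=> [K [cK clK] KU].
  have [M [Mreal Mb]] := compact_bounded cK.
  pose r := Num.bound (2 * (`|M| + 1)).
  have Kr w : K w -> `|w| <= r%:R / 2.
    move=> Kw; apply: (@le_trans _ _ (`|M| + 1)).
      by apply: Mb => //; rewrite (le_lt_trans (ler_norm _))// ltrDl.
    by rewrite ler_pdivlMr// mulrC ltW// archi_boundP// mulr_ge0// addr_ge0.
  have : nbhs (sphere_Phi (G t))
      [set x : Phi R N N | forall w, K w -> ~ Phi_slice x (slab_of w)].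
    apply: open_nbhs_nbhs; split; first exact: open_misses_slice Kr.
    by rewrite Gt => w _ /Phi_image_sphere.
  move=> /cG; apply: (@filterS _ (nbhs t)) => s sK; apply: KU.
  case Gs : (G s) => [w|]; [left|by right]; exists w => // /sK; apply.
  by apply/Phi_image_sphere; rewrite Gs.
Qed.

End Sphere_inclusion.

(** * The contracting homotopy *)

Section Isolation_radius.
Variables (R : realType) (N : nat).
Local Notation X := (slab R N N).
Implicit Types (x : Phi R N N) (a b : R).

Definition at_most_one (B : set 'rV[R]_N) (A : set X) : Prop :=
  forall y z, A y -> A z -> B (slab_val y) -> B (slab_val z) -> y = z.

(** The cap 1 keeps the set bounded even if the slice has at most one point, and confines the
    conditions to the box of size 2, whose half-side is 1. *)
Definition isolating x : set R :=
  [set a | a <= 1 /\ at_most_one [set v | `|v| < a] (Phi_slice x)].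

Definition isolation_radius x : R := sup (isolating x).

Lemma isolating_le x a b : a <= b -> isolating x b -> isolating x a.
Proof.
move=> ab [b1 B1]; split=> [|y z Ay Az yb zb]; first exact: le_trans b1.
by apply: B1 => //; exact: lt_le_trans ab.
Qed.

Lemma conf_box2 (y : X) : `|slab_val y| <= 1 -> conf_box 2 (0, y).
Proof.
move=> y1; rewrite -[y]slab_valK; apply: conf_box_norm.
by rewrite divff ?pnatr_eq0.
Qed.

Lemma isolating_gt0 x : exists2 a, 0 < a & isolating x a.
Proof.
have slE (y : X) : `|slab_val y| <= 1 ->
    Phi_slice x y <-> im (stage_repr (Phi_proj 2 x)) (0, y).
  by move=> y1; exact/Phi_image_repr/conf_box2.
move: slE; case: (stage_repr _) => n phi slE.
pose c := conf_point (repr (path_fun phi 0).2).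
(* Below the least nonzero norm in a finite representative only the point 0 can occur. *)
exists (\big[Num.min/1]_(i < n | slab_val (c i) != 0) `|slab_val (c i)|).
  by apply/bigmin_gtP; split=> // i; rewrite normr_gt0.
split; first exact: bigmin_le_id.
move=> y z xy xz ya za.
have le1 (v : 'rV[R]_N) :
    `|v| < \big[Num.min/1]_(i < n | slab_val (c i) != 0) `|slab_val (c i)| ->
    `|v| <= 1.
  by move=> /lt_le_trans va; apply/ltW/va/bigmin_le_id.
have eq0 w : Phi_slice x w ->
    `|slab_val w| < \big[Num.min/1]_(i < n | slab_val (c i) != 0) `|slab_val (c i)| ->
    slab_val w = 0.
  move=> xw wa; have /(slE w (le1 _ wa))[_ /= <- [i _ ciw]] := xw.
  apply/eqP/negPn/negP => w0; have := wa; rewrite ltNge => /negP; apply.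
  have -> : w = c i by rewrite -ciw.
  by apply: (bigmin_le_cond _ (fun i => `|slab_val (c i)|)); rewrite /c ciw.
by rewrite -[y]slab_valK (eq0 y xy ya) -[z]slab_valK (eq0 z xz za).
Qed.

Lemma has_sup_isolating x : has_sup (isolating x).
Proof.
split; first by have [a _ xa] := isolating_gt0 x; exists a.
by exists 1 => a [].
Qed.

Lemma isolation_radius_gt0 x : 0 < isolation_radius x.
Proof.
have [a a0 xa] := isolating_gt0 x; apply: lt_le_trans a0 _.
exact: ub_le_sup (has_sup_isolating x).2 _ xa.
Qed.

Lemma isolation_radius_le1 x : isolation_radius x <= 1.
Proof. by apply: ge_sup (has_sup_isolating x).1 _ => a []. Qed.

(** The supremum is itself isolating since the balls are open: two norms below it lie below some
    isolating radius. *)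
Lemma isolation_radius_at_most_one x :
  at_most_one [set v | `|v| < isolation_radius x] (Phi_slice x).
Proof.
move=> y z xy xz yr zr.
have : Num.max `|slab_val y| `|slab_val z| < isolation_radius x.
  by rewrite gt_max; apply/andP.
move=> /(sup_gt (has_sup_isolating x).1)[a [_ xa]].
by rewrite gt_max => /andP[ya za]; exact: xa.
Qed.

Lemma norm_conf_continuous n (i : 'I_n) :
  continuous (fun c : ordered_conf n X => `|slab_val (conf_point c i)|).
Proof.
apply: continuousT_comp; first exact: slab_conf_continuous.
exact: norm_continuous.
Qed.

(** Of two distinct points one lies strictly outside the closed ball, and it stays outside under
    small moves. *)
Lemma open_at_most_one b : b <= 1 ->
  open [set x : Phi R N N | at_most_one [set v | `|v| <= b] (Phi_slice x)].
Proof.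
move=> b1; apply: (@open_slice R N N (at_most_one [set v | `|v| <= b]) 2).
  move=> A; split=> A1 y z Ay Az yb zb; first by apply: A1 => //; [case: Ay|case: Az].
  have box (w : X) : `|slab_val w| <= b -> conf_box 2 (0, w).
    by move=> wb; apply/conf_box2/(le_trans wb).
  by apply: A1 => //; split=> //; exact: box.
move=> n; rewrite openE => c c1.
have far i : b < `|slab_val (conf_point c i)| ->
    \forall d \near c, b < `|slab_val (conf_point d i)|.
  by move=> ci; exact: (@norm_conf_continuous _ i c _
    (open_nbhs_nbhs (conj (@open_gt _ b) ci))).
have : \forall d \near c, forall ij : 'I_n * 'I_n, ij.1 != ij.2 ->
    `|slab_val (conf_point d ij.1)| <= b -> b < `|slab_val (conf_point d ij.2)|.
  apply: (@filter_forall _ _ (fun (ij : 'I_n * 'I_n) (d : ordered_conf n X) =>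
    ij.1 != ij.2 -> `|slab_val (conf_point d ij.1)| <= b ->
    b < `|slab_val (conf_point d ij.2)|) (nbhs c)) => -[i j] /=.
  have [->|ij] := eqVneq i j; first exact: filterE.
  have [ci|/far] := leP `|slab_val (conf_point c i)| b; last first.
    by apply: (@filterS _ (nbhs c)) => d di _; rewrite leNgt di.
  have [cj|/far] := leP `|slab_val (conf_point c j)| b; last first.
    by apply: (@filterS _ (nbhs c)) => d dj.
  suff /conf_point_inj ij' : conf_point c i = conf_point c j by rewrite ij' eqxx in ij.
  exact: c1.
apply: (@filterS _ (nbhs c)) => d d1 _ _ [i _ <-] [j _ <-] ib jb.
have [->//|ij] := eqVneq i j.
by have := d1 (i, j) ij ib; rewrite ltNge jb.
Qed.

(** Two points with distinct indices stay in the open ball under small moves, and stay distinct by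
    injectivity of configurations. *)
Lemma open_not_at_most_one b : b <= 1 ->
  open [set x : Phi R N N | ~ at_most_one [set v | `|v| < b] (Phi_slice x)].
Proof.
move=> b1; apply: (@open_slice R N N (fun A => ~ at_most_one [set v | `|v| < b] A) 2).
  move=> A; split; apply: contra_not => A1 y z Ay Az yb zb; last first.
    by apply: A1 => //; [case: Ay|case: Az].
  have box (w : X) : `|slab_val w| < b -> conf_box 2 (0, w).
    by move=> wb; apply/conf_box2/(le_trans (ltW wb)).
  by apply: A1 => //; split=> //; exact: box.
move=> n; rewrite openE => c c1.
have near_lt i : `|slab_val (conf_point c i)| < b ->
    \forall d \near c, `|slab_val (conf_point d i)| < b.
  by move=> ci; exact: (@norm_conf_continuous _ i c _
    (open_nbhs_nbhs (conj (@open_lt _ b) ci))).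
have [i [j [ij ci cj]]] : exists i j, [/\ i != j,
    `|slab_val (conf_point c i)| < b & `|slab_val (conf_point c j)| < b].
  apply: contra_notP c1 => n1 _ _ [i _ <-] [j _ <-] ib jb.
  by have [->//|ij] := eqVneq i j; case: n1; exists i, j.
have := @filterI _ (nbhs c) (nbhs_filter c) _ _ (near_lt i ci) (near_lt j cj).
apply: (@filterS _ (nbhs c)) => d [di dj] d1.
have /conf_point_inj ij' : conf_point d i = conf_point d j.
  exact: d1.
by rewrite ij' eqxx in ij.
Qed.

(** The closed ball of radius [isolation_radius x - e / 2] has at most one point, which persists
    near x and bounds the radius from below. Dually, a larger open ball has two points, which bounds
    it from above. *)
Lemma isolation_radius_continuous : continuous (isolation_radius : Phi R N N -> R).
Proof.
move=> x; apply/(@cvgrPdist_lt _ _ _ (nbhs x) (nbhs_filter x)) => e e0.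
have lower : \forall y \near x, isolation_radius x - e / 2 <= isolation_radius y.
  have b1 : isolation_radius x - e / 2 <= 1.
    by rewrite (le_trans _ (isolation_radius_le1 x))// gerBl divr_ge0// ltW.
  have := open_nbhs_nbhs (conj (open_at_most_one b1) _); move=> /(_ x)[].
    move=> y z xy xz yb zb; apply: (isolation_radius_at_most_one (x := x)) => //=;
      [apply: le_lt_trans yb _|apply: le_lt_trans zb _];
      by rewrite gtrBl divr_gt0.
  move=> U [oU Ux US]; exists U; split=> // y /US y1.
  apply: ub_le_sup (has_sup_isolating y).2 _ _; split=> // z w yz yw zb wb.
  by apply: y1 => //; exact: ltW.
have upper : \forall y \near x, isolation_radius y <= isolation_radius x + e / 2.
  (* Beyond 1 the cap already gives the upper bound. *)
  have [b1|b1] := leP (isolation_radius x + e / 2) 1; last first.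
    by apply: filterE => y; apply: le_trans (isolation_radius_le1 y) (ltW b1).
  have := open_nbhs_nbhs (conj (open_not_at_most_one b1) _); move=> /(_ x)[].
    move=> x1; have := ub_le_sup (has_sup_isolating x).2 (conj b1 x1).
    by rewrite -/(isolation_radius x) leNgt ltrDl divr_gt0.
  move=> U [oU Ux US]; exists U; split=> // y /US y1.
  apply: ge_sup (has_sup_isolating y).1 _ => a ya; rewrite leNgt; apply/negP => ba.
  by apply: y1; have [] := isolating_le (ltW ba) ya.
have := @filterI _ (nbhs x) (nbhs_filter x) _ _ lower upper.
apply: (@filterS _ (nbhs x)) => y [lo up]; rewrite ltr_distl.
by apply/andP; split; lra.
Qed.

End Isolation_radius.

(* The homotopy inverse is [H 1], corestricted to X. *)
Lemma embedding_homotopy_equivalence (R : realType) (X Y : ptopologicalType)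
    (f : pmap X Y) (H : R -> pmap Y Y) :
  injective f ->
  (forall (T : topologicalType) (G : T -> X), continuous (f \o G) -> continuous G) ->
  continuous (fun yt : Y * R => H yt.2 yt.1) ->
  H 0 =1 id ->
  (forall y, exists x, f x = H 1 y) ->
  (forall t x, exists x', f x' = H t (f x)) ->
  exists g : pmap Y X, pmap_homotopic R (pmap_comp g f) (pmap_id X) /\
                       pmap_homotopic R (pmap_comp f g) (pmap_id Y).
Proof.
move=> f_inj f_emb cH H0 /choice[g gE] fH.
(* The homotopy restricts to X: lifts along f are unique by injectivity, and continuous by
   [f_emb]. *)
have /choice[K KE] : forall xt : X * R, exists x, f x = H xt.2 (f xt.1).
  by move=> xt; exact: fH.
(* Time is reversed because the homotopies wanted run from the composites to the identities. *)
have cHrev : continuous (fun yt : Y * R => H (1 - yt.2) yt.1).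
  apply: (continuousT_comp (f := fun yt : Y * R => (yt.1, 1 - yt.2))) cH.
  apply: pair_continuous; first exact: fst_continuous.
  move=> yt; apply: cvgB; [exact: cvg_cst|exact: cvg_snd].
have cg : continuous g.
  apply: f_emb; rewrite (_ : f \o g = H 1); first exact: pmap_continuous.
  by apply/funext => y; exact: gE.
have gp : g point = point by apply: f_inj; rewrite gE !pmap_point.
have cK : continuous (fun xt : X * R => K (xt.1, 1 - xt.2)).
  apply: f_emb; rewrite (_ : _ \o _ = (fun yt : Y * R => H (1 - yt.2) yt.1) \o
      (fun xt : X * R => (f xt.1, xt.2))); last by apply/funext => xt /=; rewrite KE.
  apply: (continuousT_comp _ cHrev); apply: pair_continuous; last exact: snd_continuous.
  by apply: continuousT_comp; [exact: fst_continuous|exact: pmap_continuous].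
have cKt t : continuous (fun x => K (x, 1 - t)).
  apply: (continuousT_comp (f := fun x : X => (x, t)) _ cK).
  by apply: pair_continuous; [move=> x; exact: cvg_id|exact: cst_continuous].
have Kp t : K (point, 1 - t) = point by apply: f_inj; rewrite KE /= !pmap_point.
exists (Pmap cg gp); split.
  exists (fun t => Pmap (@cKt t) (Kp t)); split=> //; apply: pmapP => x;
    by apply: f_inj; rewrite /= KE /= ?subr0 ?gE// subrr H0.
exists (fun t => H (1 - t)); split=> //; apply: pmapP => y.
  by rewrite subr0 -gE.
by rewrite subrr H0.
Qed.

(** * The zoom homotopy and the level equivalences *)

Section Level_equivalence.
Variables (R : realType) (N : nat).

(** The radius is that of x itself, as time contraction does not change the slice at time 0. At t =
    1 the isolating ball is stretched over the whole space. *)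
Definition zoom (t : R) (x : Phi R N N) : Phi R N N :=
  Phi_expand (t / isolation_radius x) (time_contract t x).

Lemma Phi_image_zoom t x p : Phi_image (zoom t x) p <->
  Phi_image x (contraction_factor t * p.1,
               shrink (t / isolation_radius x) p.2).
Proof. by rewrite Phi_image_expand /= Phi_image_time_contract. Qed.

Lemma zoom_continuous : continuous (fun xt : Phi R N N * R => zoom xt.2 xt.1).
Proof.
apply: (continuousT_comp (f := fun xt : Phi R N N * R =>
  (time_contract xt.2 xt.1, xt.2 / isolation_radius xt.1)))
  (@Phi_expand_continuous R N).
apply: pair_continuous; first exact: time_contract_continuous.
move=> xt; apply: cvgM; first exact: cvg_snd.
apply: cvgV; first by rewrite gt_eqF ?isolation_radius_gt0.
apply: (continuousT_comp (f := fst) (g := @isolation_radius R N)).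
  exact: fst_continuous.
exact: isolation_radius_continuous.
Qed.

Lemma zoom_continuousr t : continuous (zoom t).
Proof.
apply: (continuousT_comp (f := fun x => (x, t)) _ zoom_continuous).
by apply: pair_continuous; [move=> x; exact: cvg_id|exact: cst_continuous].
Qed.

Lemma zoom_point t : zoom t point = point.
Proof.
apply: Phi_imageP; apply/seteqP; split=> p; first move=> /Phi_image_zoom;
  by rewrite !Phi_image_point.
Qed.

Definition zoom_pmap (t : R) : pmap (Phi R N N) (Phi R N N) :=
  Pmap (@zoom_continuousr t) (zoom_point t).

Lemma zoom0 x : zoom 0 x = x.
Proof.
apply: Phi_imageP; apply/seteqP; split=> -[s y].
  by move=> /Phi_image_zoom; rewrite mul0r shrink0 /contraction_factor normr0 subr0
    max_r ?ler01// mul1r.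
by move=> xp; apply/Phi_image_zoom; rewrite mul0r shrink0 /contraction_factor normr0
  subr0 max_r ?ler01// mul1r.
Qed.

(** The contraction factor is 0, so the image is constant in time, and [shrink] lands in the open
    isolating ball, where the slice has at most one point. *)
Lemma zoom1_range x : exists v, sphere_Phi R N v = zoom 1 x.
Proof.
have r0 := isolation_radius_gt0 x.
apply: (sphere_Phi_range (P := fun y =>
  Phi_slice x (shrink (1 / isolation_radius x) y))) => [p|y z xy xz].
  rewrite Phi_image_zoom /contraction_factor normr1 subrr maxxx mul0r.
  by rewrite /Phi_slice.
apply: (@shrink_inj _ _ (1 / isolation_radius x)).
have lt (w : slab R N N) :
    `|slab_val (shrink (1 / isolation_radius x) w)| < isolation_radius x.
  have := @norm_shrink R N (1 / isolation_radius x) w.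
  rewrite div1r invr_eq0 gt_eqF// => /(_ isT).
  by rewrite normfV gtr0_norm// invrK.
exact: (isolation_radius_at_most_one xy xz (lt y) (lt z)).
Qed.

(** The pullback of one constant point along an injective map is constant with at most one point, at
    every t. *)
Lemma zoom_sphere_range t v : exists w, sphere_Phi R N w = zoom t (sphere_Phi R N v).
Proof.
pose u := t / isolation_radius (sphere_Phi R N v).
apply: (sphere_Phi_range (P := fun y =>
  if v is Some v' then shrink u y = slab_of v' else False)) => [p|y z].
  by rewrite Phi_image_zoom Phi_image_sphere.
by case: v @u => // v' u yv zv; apply: (@shrink_inj _ _ u); rewrite yv zv.
Qed.

Lemma sphere_Phi_homotopy_equivalence :
  exists g : pmap (Phi R N N) (sphere R N),
    pmap_homotopic R (pmap_comp g (sphere_Phi R N)) (pmap_id _) /\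
    pmap_homotopic R (pmap_comp (sphere_Phi R N) g) (pmap_id _).
Proof.
apply: (embedding_homotopy_equivalence (H := zoom_pmap)).
- exact: sphere_Phi_inj.
- exact: sphere_Phi_embedding.
- exact: zoom_continuous.
- exact: zoom0.
- exact: zoom1_range.
- exact: zoom_sphere_range.
Qed.

End Level_equivalence.

(** Both sides are the constant path at [snoc v t], or empty if v or t is infinite. This strict
    equality makes the inclusions a map of spectra. *)
Lemma sphere_Phi_translate (R : realType) (N : nat) (xt : sphere R N * circle R) :
  sphere_Phi R N.+1 (sphere_snoc xt) = Phi_translate (sphere_Phi R N xt.1, xt.2).
Proof.
case: xt => -[v|] [t|] //=; last by rewrite Phi_translate_pointl.
apply: PhiP => r; rewrite -[RHS]/(stage_translate t (stage_class r (constant_paths v))).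
rewrite stage_translate_class; apply/stage_classP/agreeP => p _.
rewrite im_constant_paths im_translate; split=> [pv|[q /im_constant_paths qv <-]].
  exists (p.1, slab_of v); first exact/im_constant_paths.
  by case: p pv => s y /= ->; congr pair; exact: val_inj.
by rewrite /= qv; exact: val_inj.
Qed.

Lemma sphere_Phi_structure (R : realType) (N : nat) :
  pmap_comp (loop_map R (sphere_Phi R N.+1)) (structure_map (sphere_spectrum R) N) =
  pmap_comp (structure_map (Phi_spectrum R) N) (sphere_Phi R N).
Proof.
apply: pmapP => x; apply: loop_funP => t.
exact: (sphere_Phi_translate (x, t)).
Qed.

Definition sphere_to_Phi (R : realType) :
    spectrum_map (sphere_spectrum R) (Phi_spectrum R) :=
  @SpectrumMap R (sphere_spectrum R) (Phi_spectrum R) (sphere_Phi R)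
    (@sphere_Phi_structure R).

Theorem lemma5p11 (R : realType) :
  spectrum_equiv (Phi_spectrum R) (sphere_spectrum R).
Proof.
(* The zigzag is a single map, pointing from the sphere spectrum to [Phi_spectrum]. *)
apply/rst_sym/rst_step; exists (sphere_to_Phi R).
pose h n := cid (@sphere_Phi_homotopy_equivalence R n).
exact: (@level_equivalence_weak_equivalence R _ _ (sphere_to_Phi R)
  (fun n => sval (h n)) (fun n => (svalP (h n)).1) (fun n => (svalP (h n)).2)).
Qed.
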